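(* Let $n,m\in\mathbb N$ and let $X,Y\in U_{m,n}(\mathbb C)$ be such that $\mathfrak m'=\mathrm{Span}_{\mathbb R}\{\hat X,\hat Y\}$ is a 2-dimensional subspace of $\mathfrak m\subset\mathfrak u(n+m)$. Consider the natural fibration $U(n)\times U(m)\to U(n+m)\to G_{n,m}(\mathbb C)$. If $X^*Y=\mu I_n$ for some $\mu\in\mathbb R$, then $\mathfrak m'$ gives rise to a complete totally geodesic surface $S$ in $G_{n,m}(\mathbb C)$.
   Context: $U_{m,n}(\mathbb C)=\{X\in M_{m,n}(\mathbb C): X^*X=\lambda I_n\text{ for some }\lambda\in\mathbb C\setminus\{0\}\}$. For $X\in M_{m,n}(\mathbb C)$, $\hat X=\begin{pmatrix}0&-X^*\\ X&0\end{pmatrix}\in\mathfrak u(n+m)$; $\mathfrak m=\{\hat X:X\in M_{m,n}(\mathbb C)\}$ and $\mathfrak h=\mathfrak u(n)+\mathfrak u(m)$ (block diagonal), so that $\mathfrak u(n+m)=\mathfrak h+\mathfrak m$ is the canonical decomposition for the affine symmetric space $G_{n,m}(\mathbb C)=U(n+m)/(U(n)\times U(m))$. The tangent space at the identity coset $o$ is identified with $\mathfrak m$. The metric on $G_{n,m}(\mathbb C)$ is the one making the projection from $U(n+m)$, with the invariant metric $\langle A,B\rangle=\frac1{n+m}\mathrm{Re}\,\mathrm{Tr}(A^*B)$ on $\mathfrak u(n+m)$, a Riemannian submersion. A subspace $\mathfrak m'\subset\mathfrak m$ ''gives rise to'' a complete totally geodesic surface if there is a complete totally geodesic surface $S\subset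 G_{n,m}(\mathbb C)$ through $o$ with $T_oS=\mathfrak m'$ (its translates by elements of $U(n+m)$ are then also complete totally geodesic surfaces to which $\mathfrak m'$ gives rise). *)

(* Defs.v *)
From mathcomp Require Import all_boot all_order all_algebra.
From mathcomp Require Import spectral complex.
From mathcomp Require Import all_classical all_reals all_analysis.
Import Order.TTheory GRing.Theory Num.Theory.
Import numFieldNormedType.Exports.

Set Implicit Arguments.
Unset Strict Implicit.
Unset Printing Implicit Defensive.

Local Open Scope classical_set_scope.
Local Open Scope ring_scope.
Local Open Scope complex_scope.
Local Open Scope sesquilinear_scope.

(** * Linear algebra *)

(* U_{m,n}(C); its elements are m x n matrices. *)
Definition Umn (R : realType) (m n : nat) : set 'M[R[i]]_(m, n) :=
  [set X | exists2 l : R[i], l != 0 & X^t* *m X = l%:M].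

Definition hat (R : realType) (m n : nat) (X : 'M[R[i]]_(m, n)) :
    'M[R[i]]_(n + m) :=
  block_mx 0 (- X^t*) X 0.

Definition spanR (R : realType) (k : nat) (A B : 'M[R[i]]_k) :
    set 'M[R[i]]_k :=
  [set C | exists a b : R, C = a%:C *: A + b%:C *: B].

Definition real_dim2 (R : realType) (k : nat) (E : set 'M[R[i]]_k) : Prop :=
  exists A B : 'M[R[i]]_k,
    (forall a b : R, a%:C *: A + b%:C *: B = 0 -> a = 0 /\ b = 0) /\
    E = spanR A B.

(* The metric (n+m)^-1 Re Tr(A^* B) on u(n+m). *)
Definition metric (R : realType) (k : nat) (A B : 'M[R[i]]_k) : R :=
  (k%:R)^-1 * complex.Re (\tr (A^t* *m B)).

(* The projection of u(n+m) = h + m onto m along h. *)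
Definition mpart (R : realType) (n m : nat) (A : 'M[R[i]]_(n + m)) :
    'M[R[i]]_(n + m) :=
  block_mx 0 (ursubmx A) (dlsubmx A) 0.

(** * Smooth matrix-valued maps *)

Fixpoint Ck (R : realType) (V : normedModType R) (k : nat) (D : set V)
    (f : V -> R^o) : Prop :=
  match k with
  | 0 => forall x, D x -> {for x, continuous f}
  | k'.+1 => (forall x, D x -> differentiable f x) /\
             (forall v : V, Ck k' D (fun x => 'D_v f x))
  end.

Definition smooth_mx (R : realType) (V : normedModType R) (p : nat)
    (D : set V) (F : V -> 'M[R[i]]_p) : Prop :=
  forall k i j, Ck k D (fun x => complex.Re (F x i j)) /\
                Ck k D (fun x => complex.Im (F x i j)).

Definition Dmx (R : realType) (V : normedModType R) (p : nat)
    (F : V -> 'M[R[i]]_p) (v x : V) : 'M[R[i]]_p :=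
  \matrix_(i, j)
    ('D_v ((fun y => complex.Re (F y i j)) : V -> R^o) x +i*
     'D_v ((fun y => complex.Im (F y i j)) : V -> R^o) x).

(** * The Grassmannian U(n+m) / (U(n) x U(m)) *)

Definition isotropy (R : realType) (n m : nat) : set 'M[R[i]]_(n + m) :=
  [set h | exists (a : 'M[R[i]]_n) (b : 'M[R[i]]_m),
     [/\ a \is unitarymx, b \is unitarymx & h = block_mx a 0 0 b]].

Definition coset (R : realType) (n m : nat) (g : 'M[R[i]]_(n + m)) :
    set 'M[R[i]]_(n + m) :=
  [set g *m h | h in @isotropy R n m].

Definition Grass (R : realType) (n m : nat) : set (set 'M[R[i]]_(n + m)) :=
  [set @coset R n m g | g in [set g | g \is unitarymx]].

(* F is a smooth lift of f to U(n+m) over D. *)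
Definition lift_on (R : realType) (n m : nat) (V : normedModType R)
    (D : set V) (f : V -> set 'M[R[i]]_(n + m))
    (F : V -> 'M[R[i]]_(n + m)) : Prop :=
  smooth_mx D F /\
  forall x, D x -> F x \is unitarymx /\ f x = @coset R n m (F x).

(* U(n+m) -> Grass is a principal bundle, so that a map into Grass is smooth
   for the quotient manifold structure iff it has smooth local lifts. *)
Definition smooth_map (R : realType) (n m : nat) (V : normedModType R)
    (D : set V) (f : V -> set 'M[R[i]]_(n + m)) : Prop :=
  forall x, D x -> exists N F, open_nbhs x N /\ @lift_on R n m V N f F.

(* For a lift F of a map into Grass, [mc F v x] in m is the m-component of the
   pull-back by F of the Maurer-Cartan form, evaluated on v. Translating by F x,
   it is the horizontal component of the derivative of F at x along v; thus it
   is the derivative of the map itself, the tangent space of Grass at the coset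
   of F x being identified with m by means of F x, and its norm for [metric] is
   the norm of that derivative for the metric on Grass which makes the
   projection a Riemannian submersion. Another lift conjugates it by an element
   of the isotropy group, which leaves [metric] unchanged. *)
Definition mc (R : realType) (n m : nat) (V : normedModType R)
    (F : V -> 'M[R[i]]_(n + m)) (v x : V) : 'M[R[i]]_(n + m) :=
  @mpart R n m ((F x)^t* *m Dmx F v x).

(* The curve c passes at time t through the coset of g, with velocity A in the
   identification by g of the tangent space there with m. *)
Definition has_velocity (R : realType) (n m : nat)
    (c : R^o -> set 'M[R[i]]_(n + m)) (t : R^o)
    (g A : 'M[R[i]]_(n + m)) : Prop :=
  exists N F, [/\ open_nbhs t N, @lift_on R n m R^o N c F, F t = g &
                  A = @mc R n m R^o F 1 t].

Definition tangent_space (R : realType) (n m : nat)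
    (S : set (set 'M[R[i]]_(n + m))) (g : 'M[R[i]]_(n + m)) :
    set 'M[R[i]]_(n + m) :=
  [set A | exists c, has_velocity c 0 g A /\
                     \forall t \near (0 : R^o), S (c t)].

(** * Surfaces and geodesics *)

Definition plane (R : realType) : normedModType R := (R^o * R^o)%type.

(* A smooth parametrization of an open part of S: an immersion which is a
   homeomorphism onto its image, open in S. In the last clause, the matrices
   g close to Phi x represent the points of Grass close to the coset of Phi x,
   the projection of U(n+m) onto Grass being continuous and open. *)
Definition is_chart (R : realType) (n m : nat)
    (S : set (set 'M[R[i]]_(n + m))) (D : set (plane R))
    (Phi : plane R -> 'M[R[i]]_(n + m)) : Prop :=
  [/\ open D,
      smooth_mx D Phi /\
        (forall x, D x -> Phi x \is unitarymx /\ S (@coset R n m (Phi x))),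
      forall x y, D x -> D y ->
        @coset R n m (Phi x) = @coset R n m (Phi y) -> x = y,
      forall x, D x -> forall v, @mc R n m (plane R) Phi v x = 0 -> v = 0 &
      forall x W, D x -> nbhs x W -> exists2 e : R, 0 < e &
        forall g : 'M[R[i]]_(n + m), g \is unitarymx -> S (@coset R n m g) ->
          (forall i j, `|g i j - Phi x i j| < e%:C) ->
          exists y, [/\ D y, W y & @coset R n m g = @coset R n m (Phi y)]].

(* A connected embedded two-dimensional submanifold of Grass. *)
Definition surface (R : realType) (n m : nat)
    (S : set (set 'M[R[i]]_(n + m))) : Prop :=
  [/\ S `<=` @Grass R n m,
      forall p, S p -> exists D Phi, @is_chart R n m S D Phi /\
        exists2 x, D x & p = @coset R n m (Phi x) &
      forall p q, S p -> S q -> exists c : R^o -> set 'M[R[i]]_(n + m),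
        [/\ smooth_map setT c, forall t, S (c t), c 0 = p & c 1 = q]].

(* For a lift F of a map (s, t) |-> f (s, t), let S and T be the partial
   derivatives of f in s and in t. This is
     d/dt <S, T> - 1/2 d/ds <T, T>,
   which is the value of <S, nabla_T T> given by Koszul's formula for the
   Levi-Civita connection, as S and T commute. *)
Definition koszul (R : realType) (n m : nat)
    (F : plane R -> 'M[R[i]]_(n + m)) (z : plane R) : R :=
  let ds : plane R := (1, 0) in
  let dt : plane R := (0, 1) in
  let S := @mc R n m (plane R) F ds in
  let T := @mc R n m (plane R) F dt in
  'D_dt ((fun w => metric (S w) (T w)) : plane R -> R^o) z
    - 2^-1 * 'D_ds ((fun w => metric (T w) (T w)) : plane R -> R^o) z.

(* c, restricted to the open interval I, is a geodesic of the submanifold M of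
   Grass, with the Riemannian metric induced on M: c stays in M and its
   covariant acceleration in M is orthogonal to every tangent vector of M,
   that is to the direction of every smooth variation of c within M.
   The case M = Grass gives the geodesics of Grass. *)
Definition geodesic (R : realType) (n m : nat)
    (M : set (set 'M[R[i]]_(n + m))) (I : set R^o)
    (c : R^o -> set 'M[R[i]]_(n + m)) : Prop :=
  [/\ smooth_map I c,
      forall t, I t -> M (c t) &
      forall t, I t -> forall (N : set (plane R)) F,
        open_nbhs ((0, t) : plane R) N ->
        smooth_mx N F ->
        (forall z, N z -> F z \is unitarymx /\ M (@coset R n m (F z))) ->
        (forall u : R^o, N (0, u) -> @coset R n m (F (0, u)) = c u) ->
        @koszul R n m F (0, t) = 0].

Definition totally_geodesic (R : realType) (n m : nat)
    (S : set (set 'M[R[i]]_(n + m))) : Prop :=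
  forall (I : set R^o) c, open I -> is_interval I ->
    @geodesic R n m S I c -> @geodesic R n m (@Grass R n m) I c.

(* Geodesic completeness: the exponential map of S is defined on the whole of
   each tangent space. *)
Definition complete (R : realType) (n m : nat)
    (S : set (set 'M[R[i]]_(n + m))) : Prop :=
  forall g A : 'M[R[i]]_(n + m), g \is unitarymx -> S (@coset R n m g) ->
    @tangent_space R n m S g A ->
    exists c, @geodesic R n m S setT c /\ @has_velocity R n m c 0 g A.

(* There is a complete totally geodesic surface S through the identity coset o
   with T_o S = E. *)
Definition gives_rise (R : realType) (n m : nat)
    (E : set 'M[R[i]]_(n + m)) : Prop :=
  exists S : set (set 'M[R[i]]_(n + m)),
    [/\ @surface R n m S, S (@coset R n m 1%:M),
        @complete R n m S, @totally_geodesic R n m S &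
        @tangent_space R n m S 1%:M = E].

(* Main.v *)
Require Import Defs.
From mathcomp Require Import all_boot all_order all_algebra.
From mathcomp Require Import spectral complex.
From mathcomp Require Import all_classical all_reals all_analysis.
From mathcomp Require Import ring lra.
Import Order.TTheory GRing.Theory Num.Theory.
Import numFieldNormedType.Exports.
Set Implicit Arguments.
Unset Strict Implicit.
Unset Printing Implicit Defensive.
Local Open Scope classical_set_scope.
Local Open Scope ring_scope.
Local Open Scope complex_scope.
Local Open Scope sesquilinear_scope.

(** Gram-Schmidt reduces the statement to X and Y with X^*X = Y^*Y = 1 and
    X^*Y = 0: this is where mu being real is used, since Y is corrected by a real
    multiple of X and the real span does not change. The columns of (1; 0),
    (0; X), (0; Y) then give an isometry J of C^n (x) C^3 into C^(n+m)
    ([frame_orth]), and SO(3), acting on the factor C^3, acts on C^(n+m) by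
    unitary matrices ([frame_act]). The surface S is the orbit [rp2] of the base
    point. Its points are the subspaces J(C^n (x) w), w a line of R^3, so that S
    is a real projective plane, and the generators of the two rotations that
    move the base point are hat X and hat Y ([frame_gen]).

    The coset of g is encoded by the orthogonal projection P = g E g^* onto the
    subspace that it represents ([coset_eqP]). The map from the Grassmannian to
    the Hermitian matrices so obtained is isometric ([metric_mc]); hence, by the
    symmetry of second derivatives, Koszul's expression for a variation P(s, t)
    is the scalar product <P_s, P_tt> ([koszulE]). This no longer involves
    lifts.

    The surface is totally geodesic because one and the same condition
    characterizes the geodesics of S and of the Grassmannian among the curves
    P(t) of S: that P and its second derivative P'' commute.
    - If they do, every variation of P in the Grassmannian has P_s = [Z, P] with
      Z skew-Hermitian ([Dmx_gproj_comm]), and <[Z, P], P''> = tr (Z [P, P'']) = 0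
      ([koszul_comm0]).
    - Conversely, P takes its values in the space of the J (1 (x) Q) J^*, Q a
      real symmetric 3 x 3 matrix. So does P'', and [P, P''] comes from a real
      skew matrix. Rotating P by the one-parameter groups of SO(3) is a variation
      within S, for which P_s = [b, P] with b skew; thus tr (b [P, P'']) = 0 for
      every generator b, and [P, P''] = 0 ([acc_commute],
      [geodesic_acc_commute]).

    Completeness follows from homogeneity: the orbits of the one-parameter groups
    of SO(3) satisfy the commutation condition for all times, and reach every
    tangent direction of S ([geodesic_one_param], [velocity_one_param],
    [tangent_space_rp2]). They also join any two points of S
    ([one_param_reach]), and longitude and latitude about each point give charts
    ([is_chart_chart]). *)

(** * Smooth real functions *)

Section RealCalculus.
Variables (R : realType) (V : normedModType R).
Implicit Types (f g : V -> R^o) (D : set V).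

(** The difference of f and g vanishes near x, so it has differential 0 there. *)
Lemma near_eq_differentiable f g x :
  (\forall y \near x, f y = g y) -> differentiable f x -> differentiable g x.
Proof.
move=> fg df.
pose h : V -> R^o := g - f.
have h0 : \forall y \near x, h y = 0.
  near=> y; rewrite [LHS]/(g y - f y).
  have -> : f y = g y by near: y.
  exact: subrr.
have hx : h \o shift x = cst (h x) + (\0 : {linear V -> R^o}) +o_ 0 id.
  apply/eqaddoP => _/posnumP[e].
  have := h0; rewrite (near_shift 0) subr0 => h0'; near=> y.
  have hy : h (y + x) = 0 by near: y.
  have -> : (h \o shift x - (cst (h x) + \0)) y = 0.
    transitivity ((h (y + x) : R) - ((h x : R) + 0)) => //.
    by rewrite hy (nbhs_singleton h0) addr0 subr0.
  by rewrite (_ : `|_| = 0) ?mulr_ge0 //; exact: normr0.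
have c0 : continuous (\0 : {linear V -> R^o}) by move=> z; exact: cvg_cst.
have dh : differentiable h x.
  by apply/diff_locallyP; rewrite (diff_unique c0 hx).
have -> : g = f + h by rewrite /h addrC subrK.
exact: differentiableD.
Unshelve. all: by end_near. Qed.

Lemma eq_Ck k D f g : open D -> (forall x, D x -> f x = g x) ->
  Ck k D f -> Ck k D g.
Proof.
move=> oD; have nearD x : D x -> \forall y \near x, D y.
  by move=> Dx; apply: open_nbhs_nbhs.
elim: k f g => [|k IH] f g fg /=.
  move=> cf x Dx; suff : g @ x --> g x by [].
  rewrite -(fg x Dx); have : f @ x --> f x by exact: cf.
  apply: cvg_trans; apply: near_eq_cvg.
  by near=> y; apply: fg; near: y; exact: nearD.
move=> [df Cf]; split=> [x Dx|v].
  apply: near_eq_differentiable (df _ Dx).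
  by near=> y; apply: fg; near: y; exact: nearD.
apply: IH (Cf v) => x Dx; apply: near_eq_derive.
by near=> y; apply: fg; near: y; exact: nearD.
Unshelve. all: by end_near. Qed.

Lemma CkS k D f : Ck k.+1 D f -> Ck k D f.
Proof.
elim: k f => [|k IH] f [df Cf].
  by move=> x Dx; exact: differentiable_continuous (df x Dx).
by split=> // v; apply: IH.
Qed.

Lemma Ck_cst k D (c : R) : Ck k D (cst c).
Proof.
elim: k c => [|k IH] c /=; first by move=> x _; exact: cvg_cst.
split=> [x _|v]; first exact: differentiable_cst.
have -> : 'D_v (cst c : V -> R^o) = cst 0 by apply/funext => x; rewrite derive_cst.
exact: IH.
Qed.

Lemma CkD k D f g : open D -> Ck k D f -> Ck k D g -> Ck k D (f + g).
Proof.
move=> oD; elim: k f g => [|k IH] f g /=.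
  by move=> cf cg x Dx; apply: continuousD; [exact: cf|exact: cg].
move=> [df Cf] [dg Cg]; split=> [x Dx|v].
  by apply: differentiableD; [exact: df|exact: dg].
apply: (@eq_Ck _ _ ('D_v f + 'D_v g : V -> R^o)) => //; last exact: IH.
move=> x Dx; rewrite -/('D_v (f + g) x) deriveD //; apply: diff_derivable.
  exact: df.
exact: dg.
Qed.

Lemma CkM k D f g : open D -> Ck k D f -> Ck k D g -> Ck k D (f * g).
Proof.
move=> oD; elim: k f g => [|k IH] f g /=.
  by move=> cf cg x Dx; apply: continuousM; [exact: cf|exact: cg].
move=> [df Cf] [dg Cg]; split=> [x Dx|v].
  by apply: differentiableM; [exact: df|exact: dg].
apply: (@eq_Ck _ _ (f * 'D_v g + g * 'D_v f : V -> R^o)) => //.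
  move=> x Dx; rewrite -/('D_v (f * g) x) deriveM //; apply: diff_derivable.
    exact: df.
  exact: dg.
by apply: CkD => //; apply: IH => //; apply: CkS; split.
Qed.

End RealCalculus.

(** Here [L] is the linear part of the affine map [A]; the hypothesis [AL] is the
    only form in which affinity enters a directional derivative. *)
Section Affine.
Variables (R : realType) (V W : normedModType R) (A L : V -> W).
Hypothesis AL : forall (h : R) v x, A (h *: v + x) = h *: L v + A x.

Lemma derive_affine (f : W -> R^o) v x : 'D_v (f \o A) x = 'D_(L v) f (A x).
Proof.
rewrite /derive.
suff -> : (fun h : R => h^-1 *: (((f \o A) \o shift x) (h *: v) - (f \o A) x)) =
  (fun h : R => h^-1 *: ((f \o shift (A x)) (h *: L v) - f (A x))) by [].
by apply/funext => h /=; rewrite AL.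
Qed.

Lemma Ck_affine k (D : set W) (E : set V) (f : W -> R^o) :
  (forall x, differentiable A x) -> (forall x, E x -> D (A x)) ->
  Ck k D f -> Ck k E (f \o A).
Proof.
move=> dA ED; elim: k f => [|k IH] f /=.
  move=> cf x Ex; apply: (@continuous_comp _ _ _ A f); last exact: (cf _ (ED _ Ex)).
  exact: differentiable_continuous.
move=> [df Cf]; split=> [x Ex|v]; last first.
  have -> : 'D_v (f \o A) = 'D_(L v) f \o A.
    by apply/funext => x; rewrite derive_affine.
  exact: IH.
by apply: differentiable_comp => //; exact: (df _ (ED _ Ex)).
Qed.

End Affine.

Section Trigonometric.
Variable R : realType.

Lemma is_derive_trig (a b x v : R) :
  is_derive (x : R^o) (v : R^o) (fun x : R^o => a * sin x + b * cos x : R^o)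
    (v * (a * cos x - b * sin x)).
Proof.
have dx : is_derive (x : R^o) (1 : R^o)
    (fun x : R^o => a * sin x + b * cos x : R^o) (a * cos x + b * (- sin x)).
  by apply: is_deriveD; apply: is_deriveZ.
have df : differentiable (fun x : R^o => a * sin x + b * cos x : R^o) x.
  by apply/derivable1_diffP; case: dx.
apply: DeriveDef; first exact: diff_derivable.
have e := derive_val (is_derive := dx).
rewrite deriveE //; rewrite deriveE // in e.
by rewrite -[v]mulr1 -[v * 1]/(v *: (1 : R^o)) linearZ e /= /GRing.scale /=; ring.
Qed.

Lemma differentiable_trig (a b x : R) :
  differentiable (fun x : R^o => a * sin x + b * cos x : R^o) x.
Proof. by apply/derivable1_diffP; case: (is_derive_trig a b x 1). Qed.

Lemma Ck_trig (D : set R^o) k (a b : R) :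
  Ck k D (fun x : R^o => a * sin x + b * cos x : R^o).
Proof.
elim: k a b => [|k IH] a b /=.
  by move=> x _; apply: differentiable_continuous; exact: differentiable_trig.
split=> [x _|v]; first exact: differentiable_trig.
have -> : 'D_v (fun x : R^o => a * sin x + b * cos x : R^o) =
   (fun x : R^o => (- (b * v)) * sin x + (a * v) * cos x : R^o).
  apply/funext => x; rewrite (derive_val (is_derive := is_derive_trig a b x v)).
  by ring.
exact: IH.
Qed.

Variables (V : normedModType R) (l : V -> R^o) (l' : V -> R^o).
Hypothesis lE : forall (h : R) v x, l (h *: v + x) = h *: l' v + l x.
Hypothesis dl : forall x, differentiable l x.

Lemma is_derive_trig_affine (a b : R) (x v : V) :
  is_derive x v (fun y => a * sin (l y) + b * cos (l y) : R^o)
    (l' v * (a * cos (l x) - b * sin (l x))).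
Proof.
have d := @differentiable_comp _ _ _ _ l _ x (dl x) (differentiable_trig a b (l x)).
apply: DeriveDef; first exact: diff_derivable d.
rewrite (@derive_affine _ _ _ l l' lE (fun x : R^o => a * sin x + b * cos x : R^o)).
exact: (derive_val (is_derive := is_derive_trig a b (l x) (l' v))).
Qed.

Lemma Ck_trig_affine k (D : set V) (a b : R) :
  Ck k D (fun y => a * sin (l y) + b * cos (l y) : R^o).
Proof.
exact: (@Ck_affine _ _ _ l l' lE k setT D _ dl (fun _ _ => I) (Ck_trig setT k a b)).
Qed.

End Trigonometric.

(** * Symmetry of second derivatives *)

Lemma dist_le_split (R : realFieldType) (a b c e : R) :
  `|a - c| < e / 2 -> `|b - c| < e / 2 -> `|a - b| <= e.
Proof.
move=> ac bc; rewrite (_ : a - b = (a - c) - (b - c)); last by ring.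
by rewrite (le_trans (ler_normB _ _)) // (splitr e) lerD // ltW.
Qed.

Section Schwarz.
Variables (R : realType) (V : normedModType R).
Implicit Types (f g : V -> R^o) (D : set V).

Lemma affine_line (v y : V) (h : R) (u s : R^o) :
  (h *: u + s) *: v + y = h *: (u *: v) + (s *: v + y).
Proof. by rewrite scalerDl scalerA addrA. Qed.

Lemma differentiable_line (v y : V) (s : R^o) :
  differentiable (fun s : R^o => s *: v + y) s.
Proof.
apply: differentiableD; last exact: differentiable_cst.
by apply: differentiableZl; exact: ex_diff.
Qed.

Lemma MVT_line g (y v : V) (h : R) : 0 < h ->
  (forall s, 0 <= s <= h -> differentiable g (s *: v + y)) ->
  exists2 s, 0 < s < h & g (h *: v + y) - g y = h * 'D_v g (s *: v + y).
Proof.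
move=> h0 dg.
pose A := fun s : R^o => s *: v + y.
have dA s : 0 <= s <= h -> is_derive (s : R^o) (1 : R^o) (g \o A) ('D_v g (A s)).
  move=> sh; have dgA : differentiable (g \o A) s.
    by apply: differentiable_comp; [exact: differentiable_line|exact: dg].
  apply: DeriveDef; first exact: diff_derivable.
  by rewrite (@derive_affine _ _ _ A ( *:%R^~ v)) ?scale1r //; exact: affine_line.
have [|||s sh] := @MVT R (g \o A) (fun s => 'D_v g (A s)) 0 h.
- by [].
- by move=> s; rewrite in_itv /= => /andP[s0 sh]; apply: dA; rewrite !ltW.
- apply: derivable_within_continuous => s; rewrite in_itv /= => sh.
  by case: (dA s sh).
rewrite in_itv /= in sh => e; exists s => //.
by rewrite mulrC; move: e; rewrite /= /A scale0r add0r subr0.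
Qed.

(** The second difference of f over the parallelogram spanned by h v and h w is a
    difference along v of the increments of f along w: apply the mean value
    theorem in the direction v, then in the direction w. *)
Lemma MVT_square D f (x v w : V) (h : R) :
  Ck 2 D f -> 0 < h ->
  (forall s t, 0 <= s <= h -> 0 <= t <= h -> D (s *: v + t *: w + x)) ->
  exists s t, [/\ 0 < s < h, 0 < t < h &
    f (h *: v + h *: w + x) - f (h *: v + x) - f (h *: w + x) + f x =
      h ^+ 2 * 'D_w ('D_v f) (s *: v + t *: w + x)].
Proof.
move=> [df Cf] h0 sD.
have hh : 0 <= h <= h by rewrite lexx ltW.
have zh : 0 <= (0 : R) <= h by rewrite lexx ltW.
pose sh := fun z : V => z + h *: w.
have dsh z : differentiable sh z.
  by apply: differentiableD; [exact: ex_diff|exact: differentiable_cst].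
pose g : V -> R^o := (f \o sh) - f.
have df1 s : 0 <= s <= h -> differentiable (f \o sh) (s *: v + x).
  move=> ?; apply: differentiable_comp; first exact: dsh.
  by apply: df; rewrite /sh addrAC; exact: sD.
have df2 s : 0 <= s <= h -> differentiable f (s *: v + x).
  by move=> ?; apply: df; have := sD s 0; rewrite scale0r addr0; apply.
have [|s s0 es] := @MVT_line g x v h h0.
  by move=> s s0; apply: differentiableB; [exact: df1|exact: df2].
have s0' : 0 <= s <= h by case/andP: s0 => *; rewrite !ltW.
have [|t t0 et] := @MVT_line ('D_v f) (s *: v + x) w h h0.
  move=> t t0; have [df' _] := Cf v; apply: df'.
  by rewrite addrA [t *: w + _]addrC; exact: sD.
exists s, t; split; [exact: s0|exact: t0|].
rewrite (_ : s *: v + _ + _ = t *: w + (s *: v + x)); last by rewrite addrCA addrA.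
rewrite expr2 -mulrA -et.
have -> : 'D_v f (h *: w + (s *: v + x)) - 'D_v f (s *: v + x) =
    'D_v g (s *: v + x).
  rewrite /g deriveB; [|exact/diff_derivable/df1|exact/diff_derivable/df2].
  rewrite (@derive_affine _ _ _ sh id); last by move=> *; rewrite /sh addrA.
  by rewrite /sh [_ + h *: w]addrC.
rewrite -es /g /sh !fctE /=.
rewrite [h *: v + x + h *: w]addrAC [x + h *: w]addrC opprB addrA.
by rewrite addrAC.
Qed.

(** The second difference is symmetric in v and w, so [MVT_square] expresses it
    by either mixed derivative, at points that tend to x with h. *)
Lemma schwarz D f (x v w : V) : open D -> D x -> Ck 2 D f ->
  'D_v ('D_w f) x = 'D_w ('D_v f) x.
Proof.
move=> oD Dx Cf; have [_ C1] := Cf.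
have c1 : {for x, continuous ('D_w ('D_v f))} by have [_ /(_ w)] := C1 v; apply.
have c2 : {for x, continuous ('D_v ('D_w f))} by have [_ /(_ v)] := C1 w; apply.
apply/eqP; rewrite -subr_eq0 -normr_le0; apply/ler_addgt0Pl => e e0; rewrite addr0.
have e20 : 0 < e / 2 by rewrite divr_gt0.
have n1 : \forall y \near x, `|'D_w ('D_v f) x - 'D_w ('D_v f) y| < e / 2.
  by move/cvgrPdist_lt : c1; apply.
have n2 : \forall y \near x, `|'D_v ('D_w f) x - 'D_v ('D_w f) y| < e / 2.
  by move/cvgrPdist_lt : c2; apply.
have n3 : \forall y \near x, D y by apply: open_nbhs_nbhs.
have cq : (fun p : R^o * R^o => p.1 *: v + p.2 *: w + x) @ (0 : R^o, 0 : R^o) --> x.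
  rewrite -[X in _ --> X]add0r; apply: cvgD; last exact: cvg_cst.
  rewrite -[X in _ --> X](addr0 (0 : V)); apply: cvgD.
    by rewrite -[X in _ --> X](scale0r v); apply: cvgZr_tmp; exact: cvg_fst.
  by rewrite -[X in _ --> X](scale0r w); apply: cvgZr_tmp; exact: cvg_snd.
have [r /= r0 rU] := (@nbhs_ballP R (R^o * R^o)%type _ _).1
  (cq _ (filterI n1 (filterI n2 n3))).
(* The parallelogram of sides h v and h w at x lies where both mixed
   derivatives are e / 2-close to their values at x. *)
pose h := r / 2; have h0 : 0 < h by rewrite divr_gt0.
have U s t : 0 <= s <= h -> 0 <= t <= h -> 
   let y := s *: v + t *: w + x in
   [/\ `|'D_w ('D_v f) x - 'D_w ('D_v f) y| < e / 2,
       `|'D_v ('D_w f) x - 'D_v ('D_w f) y| < e / 2 & D y].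
  move=> /andP[s0 sh] /andP[t0 th] y.
  have hr : h < r by rewrite /h ltr_pdivrMr // ltr_pMr // ltr1n.
  have sb : ball ((0, 0) : R^o * R^o) r ((s, t) : R^o * R^o).
    by split; rewrite /= /ball /= sub0r normrN ger0_norm // (le_lt_trans _ hr).
  have [u1 [u2 u3]] := rU _ sb.
  by split; [exact: u1|exact: u2|exact: u3].
have [|s [t [s0 t0 e1]]] := @MVT_square D f x v w h Cf h0.
  by move=> s t s0 t0; have [] := U s t s0 t0.
have [|t' [s' [t0' s0' e2]]] := @MVT_square D f x w v h Cf h0.
  by move=> t' s' t0' s0'; rewrite [t' *: w + _]addrC; have [] := U s' t' s0' t0'.
have W a : 0 < a < h -> 0 <= a <= h by case/andP=> *; rewrite !ltW.
have [u1 _ _] := U s t (W _ s0) (W _ t0).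
have [_ u2 _] := U s' t' (W _ s0') (W _ t0').
have e3 : 'D_w ('D_v f) (s *: v + t *: w + x) = 'D_v ('D_w f) (s' *: v + t' *: w + x).
  have h2 : h ^+ 2 != 0 by rewrite expf_neq0 // gt_eqF.
  rewrite [t' *: w + _]addrC [h *: w + _]addrC in e2.
  apply: (mulfI h2); rewrite -[LHS]e1 -[RHS]e2.
  by congr (_ + _); rewrite addrAC.
by rewrite e3 in u1; exact: dist_le_split u2 u1.
Qed.

End Schwarz.

(** * Smooth matrix-valued maps *)

(** Conjugate transposition, typed over [R[i]] itself: [A^t*] is a matrix over the
    closed field structure of [R[i]], and products of matrices over the two
    structures are only convertible. *)
Definition adjmx (R : realType) p q (A : 'M[R[i]]_(p, q)) : 'M[R[i]]_(q, p) := A^t*.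

Local Notation "A ^H" := (adjmx A) (at level 8, format "A ^H").

Section ComplexParts.
Variable R : realType.
Implicit Types x y : R[i].

Lemma ReD x y : complex.Re (x + y) = complex.Re x + complex.Re y.
Proof. by case: x; case: y. Qed.

Lemma ImD x y : complex.Im (x + y) = complex.Im x + complex.Im y.
Proof. by case: x; case: y. Qed.

Lemma ReM x y : complex.Re (x * y) =
  complex.Re x * complex.Re y - complex.Im x * complex.Im y.
Proof. by case: x; case: y. Qed.

Lemma ImM x y : complex.Im (x * y) =
  complex.Re x * complex.Im y + complex.Im x * complex.Re y.
Proof. by case: x; case: y. Qed.

Lemma ReN x : complex.Re (- x) = - complex.Re x. Proof. by case: x. Qed.

Lemma ImN x : complex.Im (- x) = - complex.Im x. Proof. by case: x. Qed.

Lemma ReJ x : complex.Re (Num.conj x) = complex.Re x. Proof. by case: x. Qed.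

Lemma ImJ x : complex.Im (Num.conj x) = - complex.Im x. Proof. by case: x. Qed.

Lemma Re_sum I (r : seq I) (F : I -> R[i]) :
  complex.Re (\sum_(i <- r) F i) = \sum_(i <- r) complex.Re (F i).
Proof. exact: (big_morph _ ReD). Qed.

Lemma Im_sum I (r : seq I) (F : I -> R[i]) :
  complex.Im (\sum_(i <- r) F i) = \sum_(i <- r) complex.Im (F i).
Proof. exact: (big_morph _ ImD). Qed.

Lemma complex_ext x y :
  complex.Re x = complex.Re y -> complex.Im x = complex.Im y -> x = y.
Proof. by case: x; case: y => /= ? ? ? ? -> ->. Qed.

End ComplexParts.

Lemma leibniz_Re (R : realType) (a b c d a' b' c' d' : R) :
  (a * c' + c * a') - (b * d' + d * b') =
  a' * c - b' * d + (a * c' - b * d').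
Proof. by ring. Qed.

Lemma leibniz_Im (R : realType) (a b c d a' b' c' d' : R) :
  (a * d' + d * a') + (b * c' + c * b') =
  a' * d + b' * c + (a * d' + b * c').
Proof. by ring. Qed.

Section MatrixCalculus.
Variables (R : realType) (V : normedModType R) (p : nat).
Implicit Types (F G : V -> 'M[R[i]]_p) (A B : 'M[R[i]]_p) (D : set V) (x v : V).

(** The matrix analogue of [is_derive]: it asserts derivability as well as the
    value, which lets the rules of differentiation compose without side
    conditions. *)
Definition is_Dmx x v F A := forall i j,
  is_derive x v ((fun y => complex.Re (F y i j)) : V -> R^o) (complex.Re (A i j)) /\
  is_derive x v ((fun y => complex.Im (F y i j)) : V -> R^o) (complex.Im (A i j)).

Lemma is_DmxE x v F A : is_Dmx x v F A -> Dmx F v x = A.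
Proof.
move=> dF; apply/matrixP => i j; rewrite mxE.
by have [dr di] := dF i j; apply: complex_ext => /=; exact: derive_val.
Qed.

Lemma smooth_is_Dmx D F x v : smooth_mx D F -> D x -> is_Dmx x v F (Dmx F v x).
Proof.
move=> sF Dx i j; rewrite mxE /=; have [[dr _] [di _]] := sF 1%N i j.
split; apply: DeriveDef; rewrite //; apply: diff_derivable.
  exact: dr.
exact: di.
Qed.

Lemma is_Dmx_cst x v A : is_Dmx x v (cst A) 0.
Proof. by move=> i j; rewrite mxE; split; exact: is_derive_cst. Qed.

Lemma is_Dmx_eq x v F A B : is_Dmx x v F A -> A = B -> is_Dmx x v F B.
Proof. by move=> dF <-. Qed.

Lemma is_DmxD x v F G A B : is_Dmx x v F A -> is_Dmx x v G B ->
  is_Dmx x v (fun y => F y + G y) (A + B).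
Proof.
move=> dF dG i j; have [? ?] := dF i j; have [? ?] := dG i j.
rewrite mxE ReD ImD; split.
- rewrite (_ : (fun y => _) = ((fun y => complex.Re (F y i j)) : V -> R^o) +
     ((fun y => complex.Re (G y i j)) : V -> R^o)); first exact: is_deriveD.
  by apply/funext => y; rewrite mxE ReD.
- rewrite (_ : (fun y => _) = ((fun y => complex.Im (F y i j)) : V -> R^o) +
     ((fun y => complex.Im (G y i j)) : V -> R^o)); first exact: is_deriveD.
  by apply/funext => y; rewrite mxE ImD.
Qed.

Lemma is_Dmx_sum (I : Type) (r : seq I) x v (F : I -> V -> 'M[R[i]]_p)
    (A : I -> 'M[R[i]]_p) :
  (forall k, is_Dmx x v (F k) (A k)) ->
  is_Dmx x v (fun y => \sum_(k <- r) F k y) (\sum_(k <- r) A k).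
Proof.
move=> dF; elim: r => [|k r IH].
  rewrite big_nil (_ : (fun y => _) = cst 0); first exact: is_Dmx_cst.
  by apply/funext => y; rewrite big_nil.
rewrite big_cons (_ : (fun y => _) =
  fun y => F k y + \sum_(l <- r) F l y); first exact: is_DmxD.
by apply/funext => y; rewrite big_cons.
Qed.

Lemma is_DmxM x v F G A B : is_Dmx x v F A -> is_Dmx x v G B ->
  is_Dmx x v (fun y => F y *m G y) (A *m G x + F x *m B).
Proof.
move=> dF dG i j; rewrite !mxE -big_split Re_sum Im_sum; split.
- pose h k : V -> R^o := ((fun y => complex.Re (F y i k)) : V -> R^o) *
      ((fun y => complex.Re (G y k j)) : V -> R^o) -
     ((fun y => complex.Im (F y i k)) : V -> R^o) *
      ((fun y => complex.Im (G y k j)) : V -> R^o).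
  rewrite (_ : (fun y => _) = \sum_(k < p) h k); last first.
    apply/funext => y; rewrite mxE Re_sum fct_sumE.
    by apply: eq_bigr => k _; rewrite ReM.
  apply: (@is_derive_sum _ _ _ p h) => k.
  have [fr fi] := dF i k; have [gr gi] := dG k j.
  apply: (is_derive_eq (is_deriveB (is_deriveM fr gr) (is_deriveM fi gi))).
  by rewrite ReD !ReM; exact: leibniz_Re.
- pose h k : V -> R^o := ((fun y => complex.Re (F y i k)) : V -> R^o) *
      ((fun y => complex.Im (G y k j)) : V -> R^o) +
     ((fun y => complex.Im (F y i k)) : V -> R^o) *
      ((fun y => complex.Re (G y k j)) : V -> R^o).
  rewrite (_ : (fun y => _) = \sum_(k < p) h k); last first.
    apply/funext => y; rewrite mxE Im_sum fct_sumE.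
    by apply: eq_bigr => k _; rewrite ImM.
  apply: (@is_derive_sum _ _ _ p h) => k.
  have [fr fi] := dF i k; have [gr gi] := dG k j.
  apply: (is_derive_eq (is_deriveD (is_deriveM fr gi) (is_deriveM fi gr))).
  by rewrite ImD !ImM; exact: leibniz_Im.
Qed.

Lemma is_Dmx_adj x v F A : is_Dmx x v F A ->
  is_Dmx x v (fun y => (F y)^H) (A^H).
Proof.
move=> dF i j; have [? ?] := dF j i; rewrite /adjmx !mxE ReJ ImJ; split.
- rewrite (_ : (fun y => _) = ((fun y => complex.Re (F y j i)) : V -> R^o)) //.
  by apply/funext => y; rewrite /adjmx !mxE ReJ.
- rewrite (_ : (fun y => _) = - ((fun y => complex.Im (F y j i)) : V -> R^o)).
    exact: is_deriveN.
  by apply/funext => y; rewrite /adjmx !mxE ImJ.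
Qed.

Lemma is_DmxZ x v (r : V -> R^o) (dr : R) A : is_derive x v r dr ->
  is_Dmx x v (fun y => (r y)%:C *: A) (dr%:C *: A).
Proof.
move=> dr' i j; rewrite mxE; split.
- rewrite (_ : (fun y => _) = r * cst (complex.Re (A i j))).
    apply: (is_derive_eq (is_deriveM dr' (is_derive_cst (complex.Re (A i j) : R^o) x v))).
    by rewrite ReM /= mul0r subr0 scaler0 add0r mulrC.
  by apply/funext => y; rewrite mxE ReM /= mul0r subr0.
- rewrite (_ : (fun y => _) = r * cst (complex.Im (A i j))).
    apply: (is_derive_eq (is_deriveM dr' (is_derive_cst (complex.Im (A i j) : R^o) x v))).
    by rewrite ImM /= mul0r addr0 scaler0 add0r mulrC.
  by apply/funext => y; rewrite mxE ImM /= mul0r addr0.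
Qed.

Lemma near_eq_Dmx x v F G : (\forall y \near x, F y = G y) ->
  Dmx F v x = Dmx G v x.
Proof.
move=> FG; apply/matrixP => i j; rewrite !mxE; congr (_ +i* _);
  by apply: near_eq_derive; apply: filterS FG => y ->.
Qed.

Lemma eq_Dmx D F G v : open D -> (forall x, D x -> F x = G x) ->
  forall x, D x -> Dmx F v x = Dmx G v x.
Proof.
move=> oD FG x Dx; apply: near_eq_Dmx.
have nD : \forall y \near x, D y by apply: open_nbhs_nbhs.
by apply: filterS nD.
Qed.

Lemma is_derive_Re_tr x v F A : is_Dmx x v F A ->
  is_derive x v ((fun y => complex.Re (\tr (F y))) : V -> R^o)
    (complex.Re (\tr A)).
Proof.
move=> dF.
rewrite (_ : (fun y => _) =
  \sum_(i < p) ((fun y => complex.Re (F y i i)) : V -> R^o)); last first.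
  by apply/funext => y; rewrite Re_sum fct_sumE.
rewrite Re_sum; apply: is_derive_sum => i.
by have [? _] := dF i i.
Qed.

Lemma smooth_mx_cst D A : smooth_mx D (cst A).
Proof. by move=> k i j; split; exact: Ck_cst. Qed.

Lemma smooth_mxW D D' F : (forall x, D' x -> D x) -> smooth_mx D F ->
  smooth_mx D' F.
Proof.
move=> DD' sF k i j; have [Cr Ci] := sF k i j.
by split; [move: Cr|move: Ci]; apply: (@Ck_affine R V V id id) => // x.
Qed.

Lemma smooth_mxM D F G : open D -> smooth_mx D F -> smooth_mx D G ->
  smooth_mx D (fun y => F y *m G y).
Proof.
move=> oD sF sG k i j.
have Ck_sum (h : 'I_p -> V -> R^o) : (forall l, Ck k D (h l)) ->
    Ck k D (\sum_(l < p) h l).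
  move=> hC; elim/big_ind : _ => //; first exact: Ck_cst.
  by move=> ? ? ? ?; exact: CkD.
have CkN h : Ck k D h -> Ck k D (- h : V -> R^o).
  move=> hC; rewrite (_ : - h = cst (-1) * h).
    by apply: CkM => //; exact: Ck_cst.
  by apply/funext => y; rewrite !fctE mulN1r.
split.
- rewrite (_ : (fun y => _) = \sum_(l < p)
    (((fun y => complex.Re (F y i l)) : V -> R^o) *
      ((fun y => complex.Re (G y l j)) : V -> R^o) -
     ((fun y => complex.Im (F y i l)) : V -> R^o) *
      ((fun y => complex.Im (G y l j)) : V -> R^o))); last first.
    apply/funext => y; rewrite mxE Re_sum fct_sumE.
    by apply: eq_bigr => l _; rewrite ReM.
  apply: Ck_sum => l; have [? ?] := sF k i l; have [? ?] := sG k l j.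
  by apply: CkD => //; [|apply: CkN]; exact: CkM.
- rewrite (_ : (fun y => _) = \sum_(l < p)
    (((fun y => complex.Re (F y i l)) : V -> R^o) *
      ((fun y => complex.Im (G y l j)) : V -> R^o) +
     ((fun y => complex.Im (F y i l)) : V -> R^o) *
      ((fun y => complex.Re (G y l j)) : V -> R^o))); last first.
    apply/funext => y; rewrite mxE Im_sum fct_sumE.
    by apply: eq_bigr => l _; rewrite ImM.
  apply: Ck_sum => l; have [? ?] := sF k i l; have [? ?] := sG k l j.
  by apply: CkD => //; exact: CkM.
Qed.

Lemma smooth_mxD D F G : open D -> smooth_mx D F -> smooth_mx D G ->
  smooth_mx D (fun y => F y + G y).
Proof.
move=> oD sF sG k i j; have [? ?] := sF k i j; have [? ?] := sG k i j; split.
- rewrite (_ : (fun y => _) = ((fun y => complex.Re (F y i j)) : V -> R^o) +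
     ((fun y => complex.Re (G y i j)) : V -> R^o)); first exact: CkD.
  by apply/funext => y; rewrite mxE ReD.
- rewrite (_ : (fun y => _) = ((fun y => complex.Im (F y i j)) : V -> R^o) +
     ((fun y => complex.Im (G y i j)) : V -> R^o)); first exact: CkD.
  by apply/funext => y; rewrite mxE ImD.
Qed.

Lemma smooth_mx_sum (I : Type) (r : seq I) D (F : I -> V -> 'M[R[i]]_p) :
  open D -> (forall k, smooth_mx D (F k)) ->
  smooth_mx D (fun y => \sum_(k <- r) F k y).
Proof.
move=> oD sF; elim: r => [|k r IH].
  rewrite (_ : (fun y => _) = cst 0); first exact: smooth_mx_cst.
  by apply/funext => y; rewrite big_nil.
rewrite (_ : (fun y => _) =
  fun y => F k y + \sum_(l <- r) F l y); first exact: smooth_mxD.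
by apply/funext => y; rewrite big_cons.
Qed.

Lemma smooth_mx_adj D F : open D -> smooth_mx D F ->
  smooth_mx D (fun y => (F y)^H).
Proof.
move=> oD sF k i j; have [? ?] := sF k j i; split.
- rewrite (_ : (fun y => _) = ((fun y => complex.Re (F y j i)) : V -> R^o)) //.
  by apply/funext => y; rewrite /adjmx !mxE ReJ.
- rewrite (_ : (fun y => _) =
    cst (-1) * ((fun y => complex.Im (F y j i)) : V -> R^o)).
    by apply: CkM => //; exact: Ck_cst.
  by apply/funext => y; rewrite /adjmx !mxE ImJ !fctE mulN1r.
Qed.

Lemma smooth_mxZ D (r : V -> R^o) A : open D -> (forall k, Ck k D r) ->
  smooth_mx D (fun y => (r y)%:C *: A).
Proof.
move=> oD Cr k i j; split.
- rewrite (_ : (fun y => _) = r * cst (complex.Re (A i j))).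
    by apply: CkM => //; exact: Ck_cst.
  by apply/funext => y; rewrite mxE ReM /= mul0r subr0.
- rewrite (_ : (fun y => _) = r * cst (complex.Im (A i j))).
    by apply: CkM => //; exact: Ck_cst.
  by apply/funext => y; rewrite mxE ImM /= mul0r addr0.
Qed.

Lemma smooth_Dmx D F v : open D -> smooth_mx D F -> smooth_mx D (Dmx F v).
Proof.
move=> oD sF k i j; have [[_ Cr] [_ Ci]] := sF k.+1 i j.
split.
- by rewrite (_ : (fun y => _) = 'D_v ((fun y => complex.Re (F y i j)) : V -> R^o));
  [exact: Cr|apply/funext => y; rewrite mxE].
- by rewrite (_ : (fun y => _) = 'D_v ((fun y => complex.Im (F y i j)) : V -> R^o));
  [exact: Ci|apply/funext => y; rewrite mxE].
Qed.

Lemma Dmx_schwarz D F x v w : open D -> D x -> smooth_mx D F ->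
  Dmx (Dmx F w) v x = Dmx (Dmx F v) w x.
Proof.
move=> oD Dx sF; apply/matrixP => i j; have [Cr Ci] := sF 2%N i j.
have DR u : (fun y => complex.Re (Dmx F u y i j)) =
    'D_u ((fun y => complex.Re (F y i j)) : V -> R^o).
  by apply/funext => y; rewrite mxE.
have DI u : (fun y => complex.Im (Dmx F u y i j)) =
    'D_u ((fun y => complex.Im (F y i j)) : V -> R^o).
  by apply/funext => y; rewrite mxE.
rewrite [LHS]mxE [RHS]mxE !DR !DI.
by rewrite (schwarz v w oD Dx Cr) (schwarz v w oD Dx Ci).
Qed.

End MatrixCalculus.

Section MatrixAffine.
Variables (R : realType) (V W : normedModType R) (A L : V -> W) (p : nat).
Hypothesis AL : forall (h : R) v x, A (h *: v + x) = h *: L v + A x.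

Lemma Dmx_affine (F : W -> 'M[R[i]]_p) v x :
  Dmx (fun y => F (A y)) v x = Dmx F (L v) (A x).
Proof.
apply/matrixP => i j; rewrite !mxE.
by congr (_ +i* _); rewrite -(derive_affine AL).
Qed.

Lemma smooth_mx_affine (D : set W) (E : set V) (F : W -> 'M[R[i]]_p) :
  (forall x, differentiable A x) -> (forall x, E x -> D (A x)) ->
  smooth_mx D F -> smooth_mx E (fun y => F (A y)).
Proof.
move=> dA ED sF k i j; have [Cr Ci] := sF k i j.
by split; [apply: (Ck_affine AL dA ED Cr)|apply: (Ck_affine AL dA ED Ci)].
Qed.

End MatrixAffine.

(** * Points of the Grassmannian as orthogonal projections *)

Section Adjoint.
Variable R : realType.

Lemma adjmxK p q (A : 'M[R[i]]_(p, q)) : A^H^H = A.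
Proof. exact: trmxCK. Qed.

Lemma adjmxM p q r (A : 'M[R[i]]_(p, q)) (B : 'M[R[i]]_(q, r)) :
  (A *m B)^H = B^H *m A^H.
Proof. by rewrite /adjmx trmx_mul map_mxM. Qed.

Lemma adjmxD p q (A B : 'M[R[i]]_(p, q)) : (A + B)^H = A^H + B^H.
Proof. by rewrite /adjmx linearD map_mxD. Qed.

Lemma adjmxN p q (A : 'M[R[i]]_(p, q)) : (- A)^H = - A^H.
Proof. by rewrite /adjmx linearN map_mxN. Qed.

Lemma adjmxZ p q (a : R) (A : 'M[R[i]]_(p, q)) : (a%:C *: A)^H = a%:C *: A^H.
Proof.
apply/matrixP => i j; rewrite /adjmx !mxE rmorphM; congr (_ * _).
exact: conjc_real.
Qed.

Lemma adjmx0 p q : (0 : 'M[R[i]]_(p, q))^H = 0.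
Proof. by rewrite /adjmx trmx0 map_mx0. Qed.

Lemma adjmx1 p : (1%:M : 'M[R[i]]_p)^H = 1%:M.
Proof. by rewrite /adjmx trmx1 map_mx1. Qed.

Lemma adj_block_mx p q r s (A : 'M[R[i]]_(p, r)) (B : 'M[R[i]]_(p, s))
    (C : 'M[R[i]]_(q, r)) (D : 'M[R[i]]_(q, s)) :
  (block_mx A B C D)^H = block_mx A^H C^H B^H D^H.
Proof. by rewrite /adjmx tr_block_mx map_block_mx. Qed.

Lemma unitaryP p (g : 'M[R[i]]_p) : g \is unitarymx <-> g *m g^H = 1%:M.
Proof. by split=> [/unitarymxP|?]; last exact/unitarymxP. Qed.

Lemma unitaryr p (g : 'M[R[i]]_p) : g \is unitarymx -> g *m g^H = 1%:M.
Proof. by move/unitaryP. Qed.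

Lemma unitaryl p (g : 'M[R[i]]_p) : g \is unitarymx -> g^H *m g = 1%:M.
Proof. by move=> /unitaryP /mulmx1C. Qed.

Lemma unitaryM p (g h : 'M[R[i]]_p) :
  g \is unitarymx -> h \is unitarymx -> g *m h \is unitarymx.
Proof.
move=> /unitaryP ug /unitaryP uh; apply/unitaryP.
by rewrite adjmxM mulmxA -(mulmxA g) uh mulmx1.
Qed.

Lemma unitaryV p (g : 'M[R[i]]_p) : g \is unitarymx -> g^H \is unitarymx.
Proof. by move=> /unitaryl ug; apply/unitaryP; rewrite adjmxK. Qed.

Lemma metricE p (A B : 'M[R[i]]_p) :
  metric A B = (p%:R)^-1 * complex.Re (\tr (A^H *m B)).
Proof. by []. Qed.

Lemma metricC p (A B : 'M[R[i]]_p) : metric A B = metric B A.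
Proof.
rewrite !metricE; congr (_ * _); rewrite -[RHS]ReJ; congr complex.Re.
rewrite (_ : A^H *m B = (B^H *m A)^H); last by rewrite adjmxM adjmxK.
by rewrite /mxtrace rmorph_sum; apply: eq_bigr => i _; rewrite /adjmx !mxE.
Qed.

End Adjoint.

Section Projection.
Variables (R : realType) (n m : nat).
Local Notation C := (R[i]).
Implicit Types (g h : 'M[C]_(n + m)).

(** The projection onto C^n, the subspace that the base point represents. *)
Definition base_proj : 'M[C]_(n + m) := block_mx 1%:M 0 0 0.
Local Notation E := base_proj.

(** The projection onto g(C^n), the subspace that the coset of g represents. *)
Definition gproj g : 'M[C]_(n + m) := g *m E *m g^H.

Lemma adj_base_proj : E^H = E.
Proof. by rewrite adj_block_mx adjmx1 !adjmx0. Qed.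

Lemma base_projK : E *m E = E.
Proof. by rewrite mulmx_block !(mulmx0, mul0mx, mul1mx, addr0). Qed.

Lemma adj_gproj g : (gproj g)^H = gproj g.
Proof. by rewrite /gproj !adjmxM adjmxK adj_base_proj mulmxA. Qed.

Lemma gproj1 : gproj 1%:M = E.
Proof. by rewrite /gproj adjmx1 mulmx1 mul1mx. Qed.

Lemma gprojM g h : gproj (g *m h) = g *m gproj h *m g^H.
Proof. by rewrite /gproj adjmxM !mulmxA. Qed.

(** A matrix commutes with a projection iff it is block diagonal in the
    corresponding decomposition. *)
Lemma isotropyP h :
  isotropy h <-> h \is unitarymx /\ h *m E = E *m h.
Proof.
split=> [[a [b [/unitaryP ua /unitaryP ub ->]]]|].
  split; last by rewrite !mulmx_block !(mulmx0, mul0mx, mulmx1, mul1mx, addr0, add0r).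
  apply/unitaryP; rewrite adj_block_mx mulmx_block !adjmx0.
  by rewrite !(mulmx0, mul0mx, addr0, add0r) ua ub -scalar_mx_block.
rewrite -[h]submxK.
move: (ulsubmx h) (ursubmx h) (dlsubmx h) (drsubmx h) => a b c d [/unitaryP].
rewrite adj_block_mx !mulmx_block !(mulmx0, mul0mx, mulmx1, mul1mx, addr0, add0r).
move=> uh /eq_block_mx[_ b0 c0 _]; move: uh; rewrite -b0 c0 !adjmx0 !(mulmx0, mul0mx, addr0, add0r).
rewrite scalar_mx_block => /eq_block_mx[ua _ _ ub].
by exists a, d; split => //; apply/unitaryP.
Qed.

Lemma isotropy1 : isotropy (1%:M : 'M[C]_(n + m)).
Proof.
apply/isotropyP; rewrite mulmx1 mul1mx; split=> //.
by apply/unitaryP; rewrite adjmx1 mulmx1.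
Qed.

Lemma isotropyM h k : isotropy h -> isotropy k -> isotropy (h *m k).
Proof.
move=> /isotropyP[uh ch] /isotropyP[uk ck]; apply/isotropyP.
by split; [exact: unitaryM|rewrite -mulmxA ck mulmxA ch mulmxA].
Qed.

Lemma isotropyV h : isotropy h -> isotropy h^H.
Proof.
move=> /isotropyP[uh ch]; apply/isotropyP; split; first exact: unitaryV.
by rewrite -[E in LHS]adj_base_proj -adjmxM -ch adjmxM adj_base_proj.
Qed.

Lemma coset_isotropy g h : isotropy h -> coset (g *m h) = coset g.
Proof.
move=> ih; apply/seteqP; split=> [_ [k ik <-]|_ [k ik <-]].
  by exists (h *m k); [exact: isotropyM|rewrite mulmxA].
have /isotropyP[uh _] := ih; have ihV := isotropyV ih.
exists (h^H *m k); first exact: isotropyM.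
by rewrite !mulmxA -(mulmxA g) (unitaryr uh) mulmx1.
Qed.

Lemma coset_mem g : coset g g.
Proof. by exists 1%:M; [exact: isotropy1|rewrite mulmx1]. Qed.

(** Two unitary matrices have the same coset iff g^* g' is in the isotropy
    group, that is commutes with E. *)
Lemma coset_eqP g g' : g \is unitarymx -> g' \is unitarymx ->
  coset g = coset g' <-> gproj g = gproj g'.
Proof.
move=> ug ug'; split=> [gg'|pp].
  have := coset_mem g; rewrite gg' => -[h /isotropyP[uh ch] <-].
  by rewrite gprojM [gproj h]/gproj ch -(mulmxA E) (unitaryr uh) mulmx1.
rewrite -[g'](mul1mx) -(unitaryr ug) -mulmxA coset_isotropy //.
apply/isotropyP; split; first exact: unitaryM (unitaryV ug) ug'.
have e : g' *m E = g *m E *m g^H *m g'.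
  by rewrite [g *m E *m _]pp -mulmxA (unitaryl ug') mulmx1.
by rewrite -mulmxA e !mulmxA (unitaryl ug) mul1mx.
Qed.

(** The reflection in C^n: conjugation by it is the geodesic symmetry at the base
    point. *)
Definition base_sym : 'M[C]_(n + m) := E + E - 1%:M.

(** Bracketing with E kills the block diagonal part and changes the sign of the
    upper right block; the reflection restores that sign. *)
Lemma mpart_comm (A : 'M[C]_(n + m)) :
  mpart A = (A *m E - E *m A) *m base_sym.
Proof.
rewrite /mpart /base_sym /base_proj -[A in RHS]submxK scalar_mx_block.
move: (ulsubmx A) (ursubmx A) (dlsubmx A) (drsubmx A) => a b c d.
rewrite !mulmx_block !(mulmx0, mul0mx, mulmx1, mul1mx, addr0, add0r).
rewrite !(opp_block_mx, add_block_mx) mulmx_block !(addr0, subr0, sub0r, oppr0).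
rewrite addrK subrr !(mulmx0, mul0mx, mulmx1, mulmxN, addr0, add0r).
by rewrite opprK.
Qed.

Lemma base_symK : base_sym *m base_sym = 1%:M.
Proof.
have xx : (E + E) *m (E + E) = (E + E) + (E + E).
  by rewrite mulmxDl !mulmxDr base_projK.
by rewrite /base_sym mulmxBl !mulmxBr xx mulmx1 !mul1mx addrK opprB addrC subrK.
Qed.

(** The reflection is unitary, so [mpart_comm] turns the metric of m into that of
    the brackets with E, which are the derivatives of the projections. *)
Lemma metric_comm (A B : 'M[C]_(n + m)) :
  metric (mpart A) (mpart B) = metric (A *m E - E *m A) (B *m E - E *m B).
Proof.
rewrite !metricE; congr (_ * complex.Re _).
have uE : base_sym *m base_sym^H = 1%:M.
  by rewrite /base_sym !(adjmxD, adjmxN) adj_base_proj adjmx1 base_symK.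
by rewrite !mpart_comm adjmxM -!mulmxA mxtrace_mulC -!mulmxA uE mulmx1.
Qed.

End Projection.

(** * Koszul's expression in terms of projections *)

Local Opaque derive Dmx.

Section Differential.
Variables (R : realType) (n m : nat) (V : normedModType R).
Local Notation C := (R[i]).
Local Notation E := (base_proj R n m).
Implicit Types (F : V -> 'M[C]_(n + m)) (A B : 'M[C]_(n + m)) (D : set V).
Implicit Types (x v w : V).

Definition unitary_on D F := forall x, D x -> F x \is unitarymx.

Lemma is_Dmx_gproj x v F A : is_Dmx x v F A ->
  is_Dmx x v (fun y => gproj (F y)) (A *m E *m (F x)^H + F x *m E *m A^H).
Proof.
move=> dF; rewrite [A *m E](_ : _ = A *m E + F x *m 0); last first.
  by rewrite mulmx0 addr0.
apply: is_DmxM; last exact: is_Dmx_adj.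
exact: is_DmxM dF (is_Dmx_cst _ _ _).
Qed.

Lemma smooth_gproj D F : open D -> smooth_mx D F ->
  smooth_mx D (fun y => gproj (F y)).
Proof.
move=> oD sF; apply: smooth_mxM => //; last exact: smooth_mx_adj.
by apply: smooth_mxM => //; exact: smooth_mx_cst.
Qed.

(** Differentiate F^* F = 1. *)
Lemma unitary_skewl D F x v A : open D -> D x -> unitary_on D F ->
  is_Dmx x v F A -> A^H *m F x + (F x)^H *m A = 0.
Proof.
move=> oD Dx uF dF; have := is_DmxM (is_Dmx_adj dF) dF => /is_DmxE <-.
rewrite -(is_DmxE (is_Dmx_cst x v 1%:M)); apply: (@eq_Dmx _ _ _ D) => //.
by move=> y Dy; rewrite (unitaryl (uF y Dy)).
Qed.

(** Differentiate F F^* = 1. *)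
Lemma unitary_skewr D F x v A : open D -> D x -> unitary_on D F ->
  is_Dmx x v F A -> A *m (F x)^H + F x *m A^H = 0.
Proof.
move=> oD Dx uF dF; have := is_DmxM dF (is_Dmx_adj dF) => /is_DmxE <-.
rewrite -(is_DmxE (is_Dmx_cst x v 1%:M)); apply: (@eq_Dmx _ _ _ D) => //.
by move=> y Dy; rewrite (unitaryr (uF y Dy)).
Qed.

(** The derivative of F E F^*, brought back to the base point by F, is the bracket
    of the Maurer-Cartan form F^* dF with E. *)
Lemma Dmx_gproj_conj D F x v : open D -> D x -> unitary_on D F ->
  smooth_mx D F ->
  (F x)^H *m Dmx (fun y => gproj (F y)) v x *m F x =
  (F x)^H *m Dmx F v x *m E - E *m ((F x)^H *m Dmx F v x).
Proof.
move=> oD Dx uF sF; have dF := smooth_is_Dmx v sF Dx.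
rewrite (is_DmxE (is_Dmx_gproj dF)) mulmxDr mulmxDl !mulmxA.
rewrite (unitaryl (uF x Dx)) mul1mx -(mulmxA _ _ (F x)).
rewrite (unitaryl (uF x Dx)) mulmx1; congr (_ + _).
have /eqP := unitary_skewl oD Dx uF dF; rewrite addr_eq0 => /eqP e.
by rewrite -mulmxA e mulmxN mulmxA.
Qed.

Lemma mc_adj F v x : mc F v x = mpart ((F x)^H *m Dmx F v x).
Proof. by []. Qed.

(** The m-component of the Maurer-Cartan form is determined by the derivative of
    the projection. *)
Lemma mcE D F x v : open D -> D x -> unitary_on D F -> smooth_mx D F ->
  mc F v x =
  (F x)^H *m Dmx (fun y => gproj (F y)) v x *m F x *m base_sym R n m.
Proof. by move=> oD Dx uF sF; rewrite (Dmx_gproj_conj v oD Dx uF sF) mc_adj mpart_comm. Qed.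

Lemma metric_unitary (g A B : 'M[C]_(n + m)) : g \is unitarymx ->
  metric (g^H *m A *m g) (g^H *m B *m g) = metric A B.
Proof.
move=> ug; rewrite !metricE; congr (_ * complex.Re _).
rewrite !adjmxM adjmxK mulmxA mxtrace_mulC !mulmxA (unitaryr ug) mul1mx.
by rewrite -!mulmxA (mulmxA g) (unitaryr ug) mul1mx.
Qed.

(** The embedding of the Grassmannian into the Hermitian matrices by projections
    is isometric. *)
Lemma metric_mc D F x v w : open D -> D x -> unitary_on D F ->
  smooth_mx D F ->
  metric (mc F v x) (mc F w x) =
  metric (Dmx (fun y => gproj (F y)) v x) (Dmx (fun y => gproj (F y)) w x).
Proof.
move=> oD Dx uF sF; rewrite !mc_adj metric_comm -[RHS](metric_unitary _ _ (uF x Dx)).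
by congr (metric _ _); apply/esym/(Dmx_gproj_conj _ oD).
Qed.

Lemma derive_metric p x v (F G : V -> 'M[C]_p) (A B : 'M[C]_p) :
  is_Dmx x v F A -> is_Dmx x v G B ->
  'D_v ((fun y => metric (F y) (G y)) : V -> R^o) x =
  metric A (G x) + metric (F x) B.
Proof.
move=> dF dG; have dFG := is_derive_Re_tr (is_DmxM (is_Dmx_adj dF) dG).
pose h : V -> R^o := fun y => complex.Re (\tr ((F y)^H *m G y)).
have dh : derivable h x v by case: dFG.
rewrite (_ : (fun y => _) = (p%:R)^-1 \*: h) // deriveZ //.
by rewrite (derive_val (is_derive := dFG)) !metricE -mulrDr mxtraceD ReD.
Qed.

(** With Z = dF F^*, which is skew-Hermitian because F is unitary, the derivative
    of F E F^* is [Z, F E F^*]. *)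
Lemma Dmx_gproj_comm D F x v : open D -> D x -> unitary_on D F ->
  smooth_mx D F ->
  exists2 Z, Z^H = - Z &
  Dmx (fun y => gproj (F y)) v x = Z *m gproj (F x) - gproj (F x) *m Z.
Proof.
move=> oD Dx uF sF; have dF := smooth_is_Dmx v sF Dx.
pose Z := Dmx F v x *m (F x)^H.
have ZE : Z^H = - Z.
  have /eqP := unitary_skewr oD Dx uF dF; rewrite addrC addr_eq0 => /eqP <-.
  by rewrite /Z adjmxM adjmxK.
exists Z => //; rewrite (is_DmxE (is_Dmx_gproj dF)) -mulmxN -ZE.
rewrite /Z adjmxM adjmxK /gproj.
congr (_ + _); rewrite !mulmxA -(mulmxA _ _ (F x)) (unitaryl (uF x Dx)).
  by rewrite mulmx1.
by rewrite mulmx1.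
Qed.

End Differential.

Lemma koszul_arith (R : realType) p (A A' B C D : 'M[R[i]]_p) : A = A' ->
  metric A B + metric C D - 2^-1 * (metric A' B + metric B A') = metric C D.
Proof. by move=> ->; rewrite [metric B _]metricC; field. Qed.

Section Koszul.
Variables (R : realType) (n m : nat).
Local Notation C := (R[i]).
Implicit Types (N : set (plane R)) (F : plane R -> 'M[C]_(n + m)) (z : plane R).
Local Notation ds := ((1, 0) : plane R).
Local Notation dt := ((0, 1) : plane R).

(** With P the projection and the metric read through P, the expression is
    <P_st, P_t> + <P_s, P_tt> - <P_ts, P_t>, where the mixed derivatives
    agree. *)
Lemma koszul_gproj (V : normedModType R) (N : set V) (F : V -> 'M[C]_(n + m))
    (z s t : V) :
  open N -> N z -> unitary_on N F -> smooth_mx N F ->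
  'D_t ((fun y => metric (mc F s y) (mc F t y)) : V -> R^o) z -
    2^-1 * 'D_s ((fun y => metric (mc F t y) (mc F t y)) : V -> R^o) z =
  metric (Dmx (fun y => gproj (F y)) s z)
    (Dmx (Dmx (fun y => gproj (F y)) t) t z).
Proof.
move=> oN Nz uF sF.
pose P y := gproj (F y); have sP : smooth_mx N P by exact: smooth_gproj.
have nN : \forall y \near z, N y by apply: open_nbhs_nbhs.
have mE v w u : 'D_u ((fun y => metric (mc F v y) (mc F w y)) : V -> R^o) z =
    metric (Dmx (Dmx P v) u z) (Dmx P w z) + metric (Dmx P v z) (Dmx (Dmx P w) u z).
  have sD a : is_Dmx z u (Dmx P a) (Dmx (Dmx P a) u z).
    by apply: (smooth_is_Dmx _ _ Nz); exact: smooth_Dmx.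
  rewrite -(derive_metric (sD v) (sD w)); apply: near_eq_derive.
  by apply: filterS nN => y Ny; rewrite (metric_mc _ _ oN).
apply: (etrans (congr2 (fun a b => a - 2^-1 * b) (mE s t t) (mE t t s))).
exact: koszul_arith (Dmx_schwarz t s oN Nz sP).
Qed.

Lemma koszulE N F z : open N -> N z -> unitary_on N F -> smooth_mx N F ->
  koszul F z = metric (Dmx (fun y => gproj (F y)) ds z)
    (Dmx (Dmx (fun y => gproj (F y)) dt) dt z).
Proof. exact: koszul_gproj. Qed.

Lemma near_eq_Dmx2 (V : normedModType R) p (F G : V -> 'M[C]_p) x v w :
  (\forall y \near x, F y = G y) -> Dmx (Dmx F v) w x = Dmx (Dmx G v) w x.
Proof.
move=> FG; apply: near_eq_Dmx; have := near_join FG; apply: filterS => y.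
exact: near_eq_Dmx.
Qed.

Lemma Dmx2_affine (V W : normedModType R) (A L : V -> W) p :
  (forall (h : R) v x, A (h *: v + x) = h *: L v + A x) ->
  forall (P : W -> 'M[C]_p) v x,
  Dmx (Dmx (fun y => P (A y)) v) v x = Dmx (Dmx P (L v)) (L v) (A x).
Proof.
move=> AL P v x; rewrite -(Dmx_affine AL); apply: (congr1 (fun G => Dmx G v x)).
by apply/funext => u; exact: (Dmx_affine AL).
Qed.

(** Koszul's expression at (0, t) depends on the variation only through P_s at
    that point and the projections p along the varied curve. *)
Lemma koszul_along N F t (p : R^o -> 'M[C]_(n + m)) :
  open N -> N (0, t) -> unitary_on N F -> smooth_mx N F ->
  (\forall u \near (t : R^o), gproj (F (0, u)) = p u) ->
  koszul F (0, t) =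
    metric (Dmx (fun y => gproj (F y)) ds (0, t)) (Dmx (Dmx p 1) 1 t).
Proof.
move=> oN Nz uF sF Fp; apply: (etrans (koszulE oN Nz uF sF)).
refine (congr1 (metric _) _); apply: etrans (near_eq_Dmx2 _ _ Fp).
pose A (u : R^o) : plane R := (0, u).
have AL (h : R) (v x : R^o) : A (h *: v + x) = h *: A v + A x.
  by rewrite /A; congr (_, _); rewrite /= scaler0 addr0.
exact: esym (Dmx2_affine AL (fun y => gproj (F y)) 1 t).
Qed.

(** Here P_s = [Z, p] and tr ([Z, p] q) = tr (Z [p, q]). *)
Lemma koszul_comm0 N F t (p : R^o -> 'M[C]_(n + m)) :
  open N -> N (0, t) -> unitary_on N F -> smooth_mx N F ->
  (\forall u \near (t : R^o), gproj (F (0, u)) = p u) ->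
  let q := Dmx (Dmx p 1) 1 t in q *m p t = p t *m q ->
  koszul F (0, t) = 0.
Proof.
move=> oN Nz uF sF Fp q qp; rewrite (koszul_along oN Nz uF sF Fp) -/q.
have [Z ZE ->] := Dmx_gproj_comm ds oN Nz uF sF.
rewrite !metricE (nbhs_singleton Fp); set a := p t in qp *.
have aE : a^H = a by rewrite /a -(nbhs_singleton Fp) adj_gproj.
rewrite adjmxD adjmxN !adjmxM ZE aE mulmxN mulNmx opprK mulmxDl mxtraceD.
rewrite mulNmx [X in X + _]raddfN /= -!mulmxA mxtrace_mulC -mulmxA qp.
by rewrite mulmxA addNr mulr0.
Qed.

End Koszul.

(** * Real 3 x 3 matrices acting through an orthonormal frame *)

Section Frame.
Variables (R : realType) (N n : nat) (L : 'I_3 -> 'M[R[i]]_(N, n)).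
Local Notation C := (R[i]).
Hypothesis LL : forall i j, (L i)^H *m L j = (i == j)%:R%:M.
Implicit Types (Q k : 'M[R]_3) (P : 'M[C]_N).

(** With J the isometry whose blocks of columns are the L i, this is
    J (1 (x) Q) J^*: a representation of the algebra of real 3 x 3 matrices. *)
Definition frame_mx Q : 'M[C]_N :=
  \sum_i \sum_j (Q i j)%:C *: (L i *m (L j)^H).
Local Notation T := frame_mx.

Lemma frame_mxD Q Q' : T (Q + Q') = T Q + T Q'.
Proof.
rewrite -big_split; apply: eq_bigr => i _; rewrite -big_split /=.
by apply: eq_bigr => j _; rewrite -scalerDl mxE rmorphD.
Qed.

Lemma frame_mxZ (a : R) Q : T (a *: Q) = a%:C *: T Q.
Proof.
rewrite scaler_sumr; apply: eq_bigr => i _; rewrite scaler_sumr.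
by apply: eq_bigr => j _; rewrite scalerA mxE rmorphM.
Qed.

Lemma frame_mxN Q : T (- Q) = - T Q.
Proof. by rewrite -scaleN1r frame_mxZ rmorphN rmorph1 scaleN1r. Qed.

Lemma frame_mxB Q Q' : T (Q - Q') = T Q - T Q'.
Proof. by rewrite frame_mxD frame_mxN. Qed.

Lemma frame_mx0 : T 0 = 0.
Proof. by rewrite -(subrr 0) frame_mxB subrr. Qed.

Lemma adj_frame_mx Q : (T Q)^H = T Q^T.
Proof.
rewrite /T [RHS]exchange_big /=.
rewrite (big_morph (@adjmx R N N) (@adjmxD R N N) (adjmx0 R N N)).
apply: eq_bigr => i _.
rewrite (big_morph (@adjmx R N N) (@adjmxD R N N) (adjmx0 R N N)).
by apply: eq_bigr => j _; rewrite adjmxZ adjmxM adjmxK mxE.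
Qed.

Lemma adj_frame_mul i Q : (L i)^H *m T Q = \sum_j (Q i j)%:C *: (L j)^H.
Proof.
rewrite mulmx_sumr (bigD1 i) //= [X in _ + X]big1 ?addr0; last first.
  move=> k ki; rewrite mulmx_sumr big1 // => j _.
  by rewrite -scalemxAr mulmxA LL eq_sym (negbTE ki) mul_scalar_mx scale0r scaler0.
rewrite mulmx_sumr; apply: eq_bigr => j _.
by rewrite -scalemxAr mulmxA LL eqxx mul_scalar_mx scale1r.
Qed.

Lemma frame_mxM Q Q' : T Q *m T Q' = T (Q *m Q').
Proof.
rewrite mulmx_suml; apply: eq_bigr => i _.
rewrite mulmx_suml.
under eq_bigr => j _.
  rewrite -scalemxAl -mulmxA adj_frame_mul mulmx_sumr scaler_sumr.
  over.
rewrite exchange_big /=; apply: eq_bigr => l _.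
rewrite mxE rmorph_sum scaler_suml; apply: eq_bigr => j _.
by rewrite -scalemxAr scalerA rmorphM.
Qed.

Lemma tr_frame_mx Q : \tr (T Q) = (n%:R * \tr Q)%:C.
Proof.
rewrite (big_morph _ (@mxtraceD _ _) (@mxtrace0 _ _)) mulr_sumr rmorph_sum.
apply: eq_bigr => i _.
rewrite (big_morph _ (@mxtraceD _ _) (@mxtrace0 _ _)) (bigD1 i) //=.
rewrite big1 ?addr0 => [|j ji]; rewrite mxtraceZ mxtrace_mulC LL.
  by rewrite eqxx mxtrace_scalar mulrC rmorphM rmorph_nat.
by rewrite (negbTE ji) mxtrace_scalar mul0rn mulr0.
Qed.

(** A left inverse of [frame_mx] that makes sense for every P, real linear and
    compatible with adjoints; tr (L j (L i)^* P) is n times the coefficient of P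
    at (i, j). *)
Definition frame_coef P : 'M[R]_3 :=
  \matrix_(i, j) ((n%:R)^-1 * complex.Re (\tr (L j *m (L i)^H *m P))).

Lemma frame_coefK Q : (0 < n)%N -> frame_coef (T Q) = Q.
Proof.
move=> n0; apply/matrixP => i j; rewrite mxE.
rewrite -mulmxA mxtrace_mulC adj_frame_mul mulmx_suml.
rewrite (big_morph _ (@mxtraceD _ _) (@mxtrace0 _ _)) (bigD1 j) //=.
rewrite big1 ?addr0 => [|k kj]; rewrite -scalemxAl mxtraceZ LL.
  rewrite eqxx mxtrace_scalar -[(_%:R *+ n)]/(n%:R : C) -(rmorph_nat (real_complex R)).
  by rewrite -rmorphM /= mulrC -mulrA mulfV ?mulr1 // pnatr_eq0 -lt0n.
by rewrite (negbTE kj) mxtrace_scalar mul0rn mulr0.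
Qed.

Lemma frame_coef_adj P : frame_coef P^H = (frame_coef P)^T.
Proof.
apply/matrixP => i j; rewrite !mxE; congr (_ * _); rewrite -[RHS]ReJ.
congr complex.Re; rewrite mxtrace_mulC.
rewrite (_ : P^H *m _ = (L i *m (L j)^H *m P)^H); last by rewrite !adjmxM adjmxK.
by rewrite /mxtrace rmorph_sum; apply: eq_bigr => l _; rewrite /adjmx !mxE.
Qed.

Section FrameCalculus.
Variables (V : normedModType R) (x v : V).

Lemma is_Dmx_frame (Q : V -> 'M[R]_3) Q' :
  (forall i j, is_derive x v ((fun y => Q y i j) : V -> R^o) (Q' i j)) ->
  is_Dmx x v (fun y => T (Q y)) (T Q').
Proof.
move=> dQ; apply: is_Dmx_sum => i; apply: is_Dmx_sum => j.
exact: is_DmxZ (dQ i j).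
Qed.

Lemma is_derive_frame_coef (F : V -> 'M[C]_N) A i j : is_Dmx x v F A ->
  is_derive x v ((fun y => frame_coef (F y) i j) : V -> R^o) (frame_coef A i j).
Proof.
move=> dF; rewrite mxE.
rewrite (_ : (fun y => _) = (n%:R)^-1 \*:
  ((fun y => complex.Re (\tr (L j *m (L i)^H *m F y))) : V -> R^o)); last first.
  by apply/funext => y; rewrite mxE.
apply: is_deriveZ; apply: is_derive_Re_tr.
apply: is_Dmx_eq (is_DmxM (is_Dmx_cst _ _ _) dF) _.
by rewrite mul0mx add0r.
Qed.

(** The image of [frame_mx] is the set of fixed points of a real linear operator,
    so it contains the derivatives of the maps with values in it. *)
Lemma Dmx_in_frame (F : V -> 'M[C]_N) A : is_Dmx x v F A ->
  (\forall y \near x, F y = T (frame_coef (F y))) -> A = T (frame_coef A).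
Proof.
move=> dF FT; rewrite -[LHS](is_DmxE dF) (near_eq_Dmx v FT).
exact: is_DmxE (is_Dmx_frame (fun i j => is_derive_frame_coef i j dF)).
Qed.

End FrameCalculus.

(** The matrix k acting on the span of the frame, the identity on its orthogonal
    complement. *)
Definition frame_act k : 'M[C]_N := 1%:M + T (k - 1%:M).
Local Notation K := frame_act.

Lemma frame_act1 : K 1%:M = 1%:M.
Proof. by rewrite /K subrr frame_mx0 addr0. Qed.

Lemma frame_actM k k' : K (k *m k') = K k *m K k'.
Proof.
rewrite /K [RHS]mulmxDl mul1mx mulmxDr mulmx1 frame_mxM -addrA.
refine (congr1 (+%R 1%:M) _); rewrite -!frame_mxD; congr (T _).
rewrite mulmxBl mul1mx mulmxBr mulmx1 [RHS]addrC -addrA subrK addrC.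
by rewrite addrA subrK.
Qed.

Lemma adj_frame_act k : (K k)^H = K k^T.
Proof. by rewrite /K adjmxD adjmx1 adj_frame_mx linearB /= trmx1. Qed.

Lemma frame_act_unitary k : k *m k^T = 1%:M -> K k \is unitarymx.
Proof.
by move=> kk; apply/unitaryP; rewrite adj_frame_act -frame_actM kk frame_act1.
Qed.

Lemma frame_actl k Q : K k *m T Q = T (k *m Q).
Proof.
by rewrite mulmxDl mul1mx frame_mxM -frame_mxD mulmxBl mul1mx addrC subrK.
Qed.

Lemma frame_actr k Q : T Q *m K k = T (Q *m k).
Proof.
by rewrite mulmxDr mulmx1 frame_mxM -frame_mxD mulmxBr mulmx1 addrC subrK.
Qed.

Lemma frame_act_conj k Q : K k *m T Q *m (K k)^H = T (k *m Q *m k^T).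
Proof. by rewrite adj_frame_act frame_actl frame_actr. Qed.

End Frame.

Section Rotation.
Variables (R : realType) (b : 'M[R]_3).
Hypotheses (bT : b^T = - b) (b3 : b *m b *m b = - b).
Local Notation B := (b *m b).

(** Rodrigues' formula for exp (t b), valid when b^3 = - b. *)
Definition rotmx (t : R) : 'M[R]_3 := 1%:M + (sin t *: b + (1 - cos t) *: B).

Lemma rotmx0 : rotmx 0 = 1%:M.
Proof. by rewrite /rotmx sin0 cos0 subrr !scale0r !addr0. Qed.

Lemma tr_rotmx t : (rotmx t)^T = 1%:M + (- (sin t *: b) + (1 - cos t) *: B).
Proof.
by rewrite /rotmx !linearD /= !linearZ /= trmx1 trmx_mul bT mulmxN mulNmx opprK scalerN.
Qed.

Lemma rotmx_orth t : rotmx t *m (rotmx t)^T = 1%:M.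
Proof.
have b3' : b *m B = - b by rewrite mulmxA.
have b4 : B *m B = - B by rewrite mulmxA b3 mulNmx.
rewrite tr_rotmx /rotmx; set s := sin t; set c := 1 - cos t.
have sc : s * s = 2 * c - c * c.
  by rewrite /s /c -expr2 sin2cos2; ring.
rewrite mulmxDl mul1mx !mulmxDr !mulmxDl !mulmx1 !mulmxN.
rewrite -!(scalemxAl, scalemxAr) !scalerA b3 b3' b4.
apply/matrixP => i j; rewrite !mxE; move: (b i j) (_ == _) => u v.
set w := \sum_j0 _.
by rewrite sc; ring.
Qed.

Lemma rotmxC t : b *m rotmx t = rotmx t *m b.
Proof.
by rewrite /rotmx !mulmxDr !mulmxDl mulmx1 mul1mx -!scalemxAr -!scalemxAl mulmxA.
Qed.

Lemma mul_rotmx t : b *m rotmx t = cos t *: b + sin t *: B.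
Proof.
rewrite /rotmx !mulmxDr mulmx1 -!scalemxAr mulmxA b3 scalerN scalerBl scale1r.
by rewrite opprB addrCA addrC [X in X + _]addrC subrK addrC.
Qed.

End Rotation.

Section RotationCurve.
Variables (R : realType) (N n : nat) (L : 'I_3 -> 'M[R[i]]_(N, n)).
Hypothesis LL : forall i j, (L i)^H *m L j = (i == j)%:R%:M.
Variables (V : normedModType R) (l l' : V -> R^o).
Hypothesis lE : forall (h : R) v x, l (h *: v + x) = h *: l' v + l x.
Hypothesis dl : forall x, differentiable l x.
Local Notation T := (frame_mx L).
Local Notation K := (frame_act L).

Lemma rotmxE (b : 'M[R]_3) t i j : (rotmx b t - 1%:M) i j =
  (b i j * sin t + - (b *m b) i j * cos t) + (b *m b) i j.
Proof. by rewrite /rotmx addrAC subrr add0r !mxE; ring. Qed.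

Lemma smooth_rotmx b (D : set V) : open D ->
  smooth_mx D (fun y => K (rotmx b (l y))).
Proof.
move=> oD; apply: smooth_mxD => //; first exact: smooth_mx_cst.
apply: smooth_mx_sum => // i; apply: smooth_mx_sum => // j.
apply: smooth_mxZ => // k.
rewrite (_ : (fun y => _) =
  ((fun y => b i j * sin (l y) + - (b *m b) i j * cos (l y)) : V -> R^o) +
  cst ((b *m b) i j)).
  by apply: CkD => //; [exact: Ck_trig_affine|exact: Ck_cst].
by apply/funext => y; rewrite rotmxE.
Qed.

Lemma is_Dmx_rotmx b x v : b *m b *m b = - b ->
  is_Dmx x v (fun y => K (rotmx b (l y)))
    ((l' v)%:C *: (T b *m K (rotmx b (l x)))).
Proof.
move=> b3; rewrite (frame_actr LL) -frame_mxZ -[T _]add0r.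
apply: is_DmxD; first exact: is_Dmx_cst.
apply: is_Dmx_frame => i j.
rewrite (_ : (fun y => _) =
  ((fun y => b i j * sin (l y) + - (b *m b) i j * cos (l y)) : V -> R^o) +
  cst ((b *m b) i j)); last by apply/funext => y; rewrite rotmxE.
have d := is_derive_trig_affine lE dl (b i j) (- (b *m b) i j) x v.
apply: is_derive_eq (is_deriveD d (is_derive_cst _ x v)) _.
by rewrite mul_rotmx // !mxE addr0; ring.
Qed.

End RotationCurve.

(** * Real and imaginary parts as coordinates *)

Section RealParts.
Variables (R : realType) (N : nat).
Local Notation C := (R[i]).
(** A copy of the complex matrices that is a normed space over the reals, so that
    the results on smooth maps yield continuity in the entries of a matrix. *)
Definition parts_space : normedModType R := ('M[R]_N * 'M[R]_N)%type.

Definition parts (g : 'M[C]_N) : parts_space :=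
  (\matrix_(i, j) complex.Re (g i j), \matrix_(i, j) complex.Im (g i j)).

Definition of_parts (A : parts_space) : 'M[C]_N :=
  \matrix_(i, j) (A.1 i j +i* A.2 i j).

Lemma partsK g : of_parts (parts g) = g.
Proof. by apply/matrixP => i j; rewrite !mxE; case: (g i j). Qed.

Lemma Ck_id k (D : set R^o) : Ck k D (id : R^o -> R^o).
Proof.
case: k => [|k] /=; first by move=> x _; exact: cvg_id.
split=> [x _|v]; first exact: ex_diff.
have -> : 'D_v (id : R^o -> R^o) = cst v by apply/funext => x; rewrite derive_id.
exact: Ck_cst.
Qed.

Lemma smooth_of_parts : smooth_mx setT of_parts.
Proof.
move=> k i j; split.
- pose A (z : parts_space) : R^o := z.1 i j.
  have AL (h : R) (v x : parts_space) : A (h *: v + x) = h *: A v + A x.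
    by rewrite /A !mxE.
  have dA x : differentiable A x.
    apply: (@differentiable_comp _ _ _ _ fst (fun M : 'M[R]_N => M i j : R^o)).
      by apply: linear_differentiable => y; exact: cvg_fst.
    exact: differentiable_coord.
  rewrite (_ : (fun x => _) = id \o A); last by apply/funext => x; rewrite mxE.
  exact: (Ck_affine AL dA (fun _ _ => I) (@Ck_id k setT)).
- pose A (z : parts_space) : R^o := z.2 i j.
  have AL (h : R) (v x : parts_space) : A (h *: v + x) = h *: A v + A x.
    by rewrite /A !mxE.
  have dA x : differentiable A x.
    apply: (@differentiable_comp _ _ _ _ snd (fun M : 'M[R]_N => M i j : R^o)).
      by apply: linear_differentiable => y; exact: cvg_snd.
    exact: differentiable_coord.
  rewrite (_ : (fun x => _) = id \o A); last by apply/funext => x; rewrite mxE.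
  exact: (Ck_affine AL dA (fun _ _ => I) (@Ck_id k setT)).
Qed.

Lemma nbhs_parts (h : 'M[C]_N) (P : set parts_space) : nbhs (parts h) P ->
  exists2 d : R, 0 < d &
    forall g : 'M[C]_N, (forall i j, `|g i j - h i j| < d%:C) -> P (parts g).
Proof.
move=> /nbhs_ballP[d /= d0 dP]; exists d => // g gh; apply: dP.
have le_part (a b : R) : `|a| <= Num.sqrt (a ^+ 2 + b ^+ 2) /\
    `|b| <= Num.sqrt (a ^+ 2 + b ^+ 2).
  by rewrite -!sqrtr_sqr; split; apply: ler_wsqrtr; rewrite ?lerDl ?lerDr sqr_ge0.
have part i j : `|complex.Re (h i j) - complex.Re (g i j)| < d /\
    `|complex.Im (h i j) - complex.Im (g i j)| < d.
  have := gh i j; rewrite normc_def ltcR ReD ImD ReN ImN => gd.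
  have [rd md] := le_part (complex.Re (g i j) - complex.Re (h i j))
    (complex.Im (g i j) - complex.Im (h i j)).
  by split; rewrite distrC; [exact: le_lt_trans rd gd|exact: le_lt_trans md gd].
by split; split=> // i j; rewrite /= !mxE; have [? ?] := part i j.
Qed.

End RealParts.

Lemma Ck_frame_coef (R : realType) (N n : nat) (L : 'I_3 -> 'M[R[i]]_(N, n))
    (V : normedModType R) (D : set V) (F : V -> 'M[R[i]]_N) k i j :
  open D -> smooth_mx D F -> Ck k D (fun y => frame_coef L (F y) i j : R^o).
Proof.
move=> oD sF; pose A := L j *m (L i)^H.
have sAF : smooth_mx D (fun y => A *m F y).
  by apply: smooth_mxM => //; exact: smooth_mx_cst.
rewrite (_ : (fun y => _) = cst (n%:R)^-1 *
  (\sum_(l < N) ((fun y => complex.Re ((A *m F y) l l)) : V -> R^o))).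
  apply: CkM => //; first exact: Ck_cst.
  elim/big_ind : _ => [|f g cf cg|l _]; first exact: Ck_cst.
    exact: CkD.
  by have [] := sAF k l l.
by apply/funext => y; rewrite mxE Re_sum !fctE fct_sumE.
Qed.
Lemma cvg_atan_ratio (R : realType) (T : Type) (F : set_system T) (FF : Filter F)
    (f g h : T -> R^o) (a b c : R^o) :
  f @ F --> a -> g @ F --> b -> h @ F --> c -> b != 0 ->
  (atan (f t / g t * h t) : R^o) @[t --> F] --> (atan (a / b * c) : R^o).
Proof.
move=> fa gb hc b0.
apply: (@continuous_cvg _ _ _ _ _ _ (atan : R^o -> R^o)); first exact: continuous_atan.
by apply: cvgM => //; apply: cvgM => //; exact: cvgV.
Qed.

(** * The projective plane spanned by two orthogonal isometries *)

Lemma forall_ord3 (P : 'I_3 -> Prop) :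
  P ord0 -> P (lift ord0 ord0) -> P (lift ord0 (lift ord0 ord0)) -> forall i, P i.
Proof.
move=> P0 P1 P2; case=> [[|[|[|//]]] i3].
- by rewrite (_ : Ordinal i3 = ord0) //; exact: val_inj.
- by rewrite (_ : Ordinal i3 = lift ord0 ord0) //; exact: val_inj.
- by rewrite (_ : Ordinal i3 = lift ord0 (lift ord0 ord0)) //; exact: val_inj.
Qed.

Section Plane.
Variables (R : realType) (n m : nat) (X Y : 'M[R[i]]_(m, n)).
Local Notation C := (R[i]).
Hypotheses (XX : X^H *m X = 1%:M) (YY : Y^H *m Y = 1%:M) (XY : X^H *m Y = 0).
Hypothesis n0 : (0 < n)%N.
Implicit Types (g h : 'M[C]_(n + m)) (k Q : 'M[R]_3) (a t : R).

(** The blocks of columns of the isometry J. *)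
Definition frame (i : 'I_3) : 'M[C]_(n + m, n) :=
  nth 0 [:: col_mx 1%:M 0; col_mx 0 X; col_mx 0 Y] i.

Lemma frame_orth i j : (frame i)^H *m frame j = (i == j)%:R%:M.
Proof.
have YX : Y^H *m X = 0 by rewrite -[X]adjmxK -adjmxM XY adjmx0.
have colE (A B : 'M[C]_n) (D F : 'M[C]_(m, n)) :
    (col_mx A D)^H *m col_mx B F = A^H *m B + D^H *m F.
  by rewrite /adjmx tr_col_mx map_row_mx mul_row_col.
move: i j; apply: forall_ord3; apply: forall_ord3;
  rewrite /frame /= colE ?adjmx1 ?adjmx0 ?mul1mx ?mulmx0 ?mul0mx ?addr0 ?add0r //;
  by rewrite ?XX ?YY ?XY ?YX ?scalemx0 //= ?mulmx0; apply/matrixP => i j; rewrite !mxE ?mul0rn.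
Qed.

Local Notation T := (frame_mx frame).
Local Notation K := (frame_act frame).
Local Notation E := (base_proj R n m).
Local Notation e := (delta_mx ord0 ord0 : 'M[R]_3).

Lemma frame_delta i j : T (delta_mx i j) = frame i *m (frame j)^H.
Proof.
rewrite /frame_mx (bigD1 i) //= [X in _ + X]big1 ?addr0; last first.
  move=> k ki; rewrite big1 // => l _.
  by rewrite mxE (negbTE ki) /= scale0r.
rewrite (bigD1 j) //= big1 ?addr0; last first.
  by move=> l lj; rewrite mxE (negbTE lj) andbF scale0r.
by rewrite mxE !eqxx scale1r.
Qed.

Lemma col_mul_adj (A B : 'M[C]_n) (D F : 'M[C]_(m, n)) :
  col_mx A D *m (col_mx B F)^H =
  block_mx (A *m B^H) (A *m F^H) (D *m B^H) (D *m F^H).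
Proof. by rewrite {1}/adjmx tr_col_mx map_row_mx mul_col_row. Qed.

Lemma frame_base : T e = E.
Proof.
rewrite frame_delta /frame /= col_mul_adj adjmx0 adjmx1.
by rewrite !(mul0mx, mulmx0, mulmx1).
Qed.

(** The skew matrix u e_0^T - e_0 u^T with u = (0, a, b) and e_0 the first vector
    of the basis: the infinitesimal rotation which moves e_0 in the direction
    u. *)
Definition gen (a b : R) : 'M[R]_3 :=
  \matrix_(i, j) nth 0 (nth [::] [:: [:: 0; - a; - b]; [:: a; 0; 0]; [:: b; 0; 0]] i) j.

Lemma tr_gen (a b : R) : (gen a b)^T = - gen a b.
Proof.
by apply/matrixP; apply: forall_ord3; apply: forall_ord3;
  rewrite !mxE /= ?oppr0 ?opprK.
Qed.

(** When u is a unit vector, gen a b generates the rotations of unit speed in the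
    plane of e_0 and u, and its square is -1 on that plane. *)
Lemma gen3 (a b : R) : a ^+ 2 + b ^+ 2 = 1 ->
  gen a b *m gen a b *m gen a b = - gen a b.
Proof.
move=> ab; have a2 : a ^+ 2 = 1 - b ^+ 2 by rewrite -ab addrK.
by apply/matrixP; apply: forall_ord3; apply: forall_ord3;
  rewrite !mxE !big_ord_recl !big_ord0 !mxE !big_ord_recl !big_ord0 !mxE /=;
  ring: a2.
Qed.

(** The space m' consists of infinitesimal rotations of the frame. *)
Lemma frame_gen (a b : R) : T (gen a b) = a%:C *: hat X + b%:C *: hat Y.
Proof.
rewrite (_ : gen a b =
  a *: (delta_mx (lift ord0 ord0) ord0 - delta_mx ord0 (lift ord0 ord0)) +
  b *: (delta_mx (lift ord0 (lift ord0 ord0)) ord0 -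
        delta_mx ord0 (lift ord0 (lift ord0 ord0)))); last first.
  by apply/matrixP; apply: forall_ord3; apply: forall_ord3;
    rewrite !mxE /=; ring.
rewrite frame_mxD !frame_mxZ !frame_mxB !frame_delta /frame /= !col_mul_adj.
rewrite !adjmx0 !adjmx1 !(mul0mx, mulmx0, mulmx1, mul1mx).
by rewrite !opp_block_mx !add_block_mx !(oppr0, addr0, add0r).
Qed.


(** The orbit of the base point under the orthogonal group of R^3. As -1 acts
    trivially on the lines of R^3, it is also the orbit under SO(3). *)
Definition rp2 : set (set 'M[C]_(n + m)) :=
  [set coset (K k) | k in [set k : 'M[R]_3 | k *m k^T = 1%:M]].
Local Notation S := rp2.

Local Notation LL := frame_orth.

Lemma frame_unitary k : k *m k^T = 1%:M -> K k \is unitarymx.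
Proof. exact: (frame_act_unitary LL). Qed.

Lemma gproj_frame k : gproj (K k) = T (k *m e *m k^T).
Proof. by rewrite /gproj -frame_base (frame_act_conj LL). Qed.

Lemma rp2P g : g \is unitarymx ->
  S (coset g) <-> exists2 k, k *m k^T = 1%:M & gproj g = T (k *m e *m k^T).
Proof.
move=> ug; split=> [[k kk kg]|[k kk kg]]; exists k => //.
  by rewrite -gproj_frame ((coset_eqP (frame_unitary kk) ug).1 kg).
by apply: (coset_eqP (frame_unitary kk) ug).2; rewrite gproj_frame kg.
Qed.

Lemma rp2_act k g : k *m k^T = 1%:M -> g \is unitarymx -> S (coset g) ->
  S (coset (K k *m g)).
Proof.
move=> kk ug /(rp2P ug)[k' kk' kg]; apply/rp2P.
  exact: unitaryM (frame_unitary kk) ug.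
exists (k *m k'); first by rewrite trmx_mul mulmxA -(mulmxA k) kk' mulmx1.
by rewrite gprojM kg (frame_act_conj LL) trmx_mul !mulmxA.
Qed.

Lemma rp2_Grass : S `<=` @Grass R n m.
Proof. by move=> _ [k kk <-]; exists (K k) => //; exact: frame_unitary. Qed.

Lemma rp2_in_frame g : g \is unitarymx -> S (coset g) ->
  gproj g = T (frame_coef frame (gproj g)).
Proof. by move=> ug /(rp2P ug)[k _ ->]; rewrite (frame_coefK LL). Qed.

Lemma frame_coef_sym (P : 'M[C]_(n + m)) : P^H = P ->
  (frame_coef frame P)^T = frame_coef frame P.
Proof. by rewrite -frame_coef_adj => ->. Qed.

(** The hypothesis says tr (b [Q, Q2]) = 0 for every generator b of a rotation. As
    Q and Q2 are symmetric, [Q, Q2] is skew, and the generators in the coordinate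
    planes extract each of its entries. *)
Lemma acc_commute (Q Q2 : 'M[R]_3) : Q^T = Q -> Q2^T = Q2 ->
  (forall b : 'M[R]_3, b^T = - b -> b *m b *m b = - b ->
     metric (T b *m T Q - T Q *m T b) (T Q2) = 0) ->
  Q *m Q2 = Q2 *m Q.
Proof.
move=> QT Q2T H; pose Z := Q *m Q2 - Q2 *m Q.
have ZT : Z^T = - Z.
  by rewrite /Z linearB /= !trmx_mul QT Q2T opprB.
have trZ (b : 'M[R]_3) : b^T = - b -> b *m b *m b = - b -> \tr (b *m Z) = 0.
  move=> bT b3; have := H b bT b3; rewrite metricE !(frame_mxM LL) -frame_mxB.
  rewrite adj_frame_mx (frame_mxM LL) (tr_frame_mx LL) linearB /= !trmx_mul bT QT.
  rewrite mulmxN mulNmx opprK addrC mulmxBl => /eqP.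
  rewrite mulrA mulf_eq0 mulf_eq0 invr_eq0 !pnatr_eq0 addn_eq0.
  rewrite (gtn_eqF n0) /= => /eqP t0.
  have c : \tr (Q *m b *m Q2) = \tr (b *m Q2 *m Q) by rewrite -mulmxA mxtrace_mulC.
  by rewrite /Z mulmxBr linearB /= !mulmxA -[RHS]t0 linearB /= c.
suff Z0 : Z = 0 by apply/eqP; rewrite -subr_eq0 -/Z Z0.
apply/matrixP => i j; rewrite [RHS]mxE.
have Zij p q : Z q p = - Z p q by have := congr1 (fun A : 'M[R]_3 => A p q) ZT; rewrite !mxE.
have [->|ij] := eqVneq i j.
  by have := Zij j j; move/eqP; rewrite -addr_eq0 -mulr2n mulrn_eq0 => /eqP.
(* tr (b Z) = Z i j - Z j i = 2 Z i j. *)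
pose b : 'M[R]_3 := delta_mx j i - delta_mx i j.
have bT : b^T = - b by rewrite /b linearB /= !trmx_delta opprB.
have dM (p q r s : 'I_3) : delta_mx p q *m delta_mx r s =
    (q == r)%:R *: delta_mx p s :> 'M[R]_3.
  by rewrite mul_delta_mx_cond scaler_nat.
have b3 : b *m b *m b = - b.
  have ji : (j == i) = false by rewrite eq_sym (negbTE ij).
  have simp := (scale0r, scale1r, subr0, sub0r, add0r, addr0).
  have bb : b *m b = - (delta_mx j j + delta_mx i i).
    by rewrite /b mulmxBl !mulmxBr !dM !eqxx (negbTE ij) ji !simp -opprD.
  by rewrite bb mulNmx /b mulmxDl !mulmxBr !dM !eqxx (negbTE ij) ji !simp.
have tr_delta (p q : 'I_3) : \tr (delta_mx p q *m Z) = Z q p.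
  rewrite /mxtrace (bigD1 p) //= big1 ?addr0 => [|r rp].
    rewrite mxE (bigD1 q) //= big1 ?addr0 => [|r rq].
      by rewrite mxE !eqxx mul1r.
    by rewrite mxE (negbTE rq) andbF mul0r.
  by rewrite mxE big1 // => s _; rewrite mxE (negbTE rp) mul0r.
have := trZ b bT b3; rewrite /b mulmxBl linearB /= !tr_delta (Zij i j).
by rewrite opprK -mulr2n => /eqP; rewrite mulrn_eq0 => /eqP.
Qed.


(** ** Total geodesy *)

Lemma Dmx_hermitian (V : normedModType R) (D : set V)
    (F : V -> 'M[C]_(n + m)) v :
  open D -> smooth_mx D F -> (forall x, D x -> (F x)^H = F x) ->
  forall x, D x -> (Dmx F v x)^H = Dmx F v x.
Proof.
move=> oD sF FH x Dx; have dF := smooth_is_Dmx v sF Dx.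
by rewrite -(is_DmxE (is_Dmx_adj dF)); apply: eq_Dmx oD FH x Dx.
Qed.

Lemma Dmx_rp2_in_frame (V : normedModType R) (D : set V)
    (F : V -> 'M[C]_(n + m)) v :
  open D -> smooth_mx D F -> (forall x, D x -> F x = T (frame_coef frame (F x))) ->
  forall x, D x -> Dmx F v x = T (frame_coef frame (Dmx F v x)).
Proof.
move=> oD sF FT x Dx; apply: Dmx_in_frame (smooth_is_Dmx v sF Dx) _.
have nD : \forall y \near x, D y by apply: open_nbhs_nbhs.
exact: filterS nD.
Qed.

Lemma Dmx_dir0 (V : normedModType R) (F : V -> 'M[C]_(n + m)) x :
  Dmx F 0 x = 0.
Proof. by apply/matrixP => i j; rewrite !mxE !derive0. Qed.

Lemma differentiable_fst (z : plane R) :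
  differentiable (fst : plane R -> R^o) z.
Proof. by apply: linear_differentiable => y; exact: cvg_fst. Qed.

Lemma differentiable_snd (z : plane R) :
  differentiable (snd : plane R -> R^o) z.
Proof. by apply: linear_differentiable => y; exact: cvg_snd. Qed.

Section Acceleration.
Variables (J : set R^o) (c : R^o -> set 'M[C]_(n + m)) (F : R^o -> 'M[C]_(n + m)).
Hypotheses (oJ : open J) (cF : lift_on J c F) (Sc : forall u, J u -> S (c u)).

Let uF : unitary_on J F. Proof. by move=> u Ju; have [_ /(_ u Ju)[]] := cF. Qed.
Let sF : smooth_mx J F. Proof. by case: cF. Qed.
Let SF u : J u -> S (coset (F u)).
Proof. by move=> Ju; have [_ /(_ u Ju)[_ <-]] := cF; exact: Sc. Qed.

(** The variation that rotates the curve by exp (s b): it stays in S, which is an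
    orbit, and its derivative at s = 0 is [b, P]. *)
Lemma koszul_rotation (b : 'M[R]_3) t : J t -> b^T = - b -> b *m b *m b = - b ->
  let G : plane R -> 'M[C]_(n + m) := fun z => K (rotmx b z.1) *m F z.2 in
  let W := [set z : plane R | J z.2] in
  [/\ open W, smooth_mx W G, forall z, W z -> G z \is unitarymx /\ S (coset (G z)),
    forall u, G (0, u) = F u &
    koszul G (0, t) =
    metric (T b *m gproj (F t) - gproj (F t) *m T b)
           (Dmx (Dmx (fun u => gproj (F u)) 1) 1 t)].
Proof.
move=> Jt bT b3 G W.
have oW : open W.
  by apply: (@open_comp _ _ (snd : plane R -> R^o) J) => // z _; exact: cvg_snd.
have sndE (h : R) (v x : plane R) : (h *: v + x).2 = h *: v.2 + x.2 by [].
have fstE (h : R) (v x : plane R) : (h *: v + x).1 = h *: v.1 + x.1 by [].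
have sF2 : smooth_mx W (fun z => F z.2).
  exact: (smooth_mx_affine sndE differentiable_snd (fun _ Wx => Wx) sF).
have sG : smooth_mx W G.
  apply: smooth_mxM => //.
  exact: (smooth_rotmx frame fstE differentiable_fst).
have uG z : W z -> G z \is unitarymx /\ S (coset (G z)).
  move=> Wz; have kk := rotmx_orth bT b3 z.1.
  split; first exact: unitaryM (frame_unitary kk) (uF Wz).
  exact: rp2_act kk (uF Wz) (SF Wz).
have G0 u : G (0, u) = F u by rewrite /G /= rotmx0 frame_act1 mul1mx.
split=> //.
have uG' : unitary_on W G by move=> z /uG[].
have WJ : W (0, t) by [].
have Gp : \forall u \near (t : R^o), gproj (G (0, u)) = gproj (F u).
  by near=> u; rewrite G0.
apply: etrans (koszul_along oW WJ uG' sG Gp) _.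
pose ds : plane R := (1, 0).
have d1 : is_Dmx (0, t) ds (fun z : plane R => K (rotmx b z.1)) (T b).
  have := is_Dmx_rotmx LL fstE differentiable_fst (0, t) ds b3.
  move=> /is_Dmx_eq; apply.
  by rewrite [rotmx b _]rotmx0 frame_act1 mulmx1 [ds.1%:C](_ : _ = 1) // scale1r.
have d2 : is_Dmx (0, t) ds (fun z : plane R => F z.2) 0.
  apply: is_Dmx_eq (smooth_is_Dmx ds sF2 WJ) _.
  by rewrite (Dmx_affine sndE F) Dmx_dir0.
have d3 : is_Dmx (0, t) ds G (T b *m F t).
  by apply: is_Dmx_eq (is_DmxM d1 d2) _; rewrite mulmx0 addr0.
refine (congr1 (fun A => metric A _) _).
rewrite (is_DmxE (is_Dmx_gproj d3)) G0 adjmxM adj_frame_mx bT frame_mxN.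
by rewrite /gproj !mulmxA mulmxN.
Unshelve. all: by end_near. Qed.

(** A geodesic of S is tested against the rotations of [koszul_rotation] only. *)
Lemma geodesic_acc_commute (t : R^o) : J t ->
  (forall (N : set (plane R)) G, open_nbhs ((0, t) : plane R) N ->
     smooth_mx N G ->
     (forall z, N z -> G z \is unitarymx /\ S (coset (G z))) ->
     (forall u : R^o, N (0, u) -> coset (G (0, u)) = c u) ->
     koszul G (0, t) = 0) ->
  let q := Dmx (Dmx (fun u => gproj (F u)) 1) 1 t in
  q *m gproj (F t) = gproj (F t) *m q.
Proof.
move=> Jt H q; pose p u := gproj (F u).
have sp : smooth_mx J p by exact: smooth_gproj.
have pT u : J u -> p u = T (frame_coef frame (p u)).
  by move=> Ju; exact: rp2_in_frame (uF Ju) (SF Ju).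
have pH u : J u -> (p u)^H = p u by move=> _; exact: adj_gproj.
have sp1 := smooth_Dmx (1 : R^o) oJ sp.
have p1T := Dmx_rp2_in_frame (1 : R^o) oJ sp pT.
have p1H := Dmx_hermitian (1 : R^o) oJ sp pH.
have qT : q = T (frame_coef frame q) := Dmx_rp2_in_frame (1 : R^o) oJ sp1 p1T Jt.
have qH : q^H = q := Dmx_hermitian (1 : R^o) oJ sp1 p1H Jt.
suff e1 : frame_coef frame (p t) *m frame_coef frame q =
     frame_coef frame q *m frame_coef frame (p t).
  have M A B : A = T (frame_coef frame A) -> B = T (frame_coef frame B) ->
      A *m B = T (frame_coef frame A *m frame_coef frame B).
    by move=> {1}-> {1}->; rewrite (frame_mxM LL).
  apply: etrans (M _ _ qT (pT t Jt)) _; rewrite -e1.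
  exact: esym (M _ _ (pT t Jt) qT).
apply: acc_commute; [exact: frame_coef_sym (pH t Jt)|exact: frame_coef_sym|].
move=> b bT b3; rewrite -(pT t Jt) -qT.
have [oW sG uG G0 <-] := koszul_rotation Jt bT b3.
apply: (H [set z : plane R | J z.2]) => //.
by move=> u Ju; rewrite G0; have [_ /(_ u Ju)[_ ->]] := cF.
Qed.

End Acceleration.

(** Commutation of P and P'' implies the geodesic equation in the whole
    Grassmannian, a fortiori in any of its subsets. *)
Lemma koszul_of_commute (J : set R^o) c F (t : R^o) :
  open J -> J t -> lift_on J c F ->
  let q := Dmx (Dmx (fun u => gproj (F u)) 1) 1 t in
  q *m gproj (F t) = gproj (F t) *m q ->
  forall (N : set (plane R)) (G : plane R -> 'M[C]_(n + m)),
    open_nbhs ((0, t) : plane R) N -> smooth_mx N G ->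
    (forall z, N z -> G z \is unitarymx) ->
    (forall u : R^o, N (0, u) -> coset (G (0, u)) = c u) ->
    koszul G (0, t) = 0.
Proof.
move=> oJ Jt [sF uF] q qp N G [oN Nz] sG uG Gc.
have nJ : \forall u \near (t : R^o), J u by apply: open_nbhs_nbhs.
have nN : \forall u \near (t : R^o), N (0, u).
  have cA : (fun u : R^o => (0 : R^o, u)) @ (t : R^o) --> ((0 : R^o, t) : plane R).
    apply: (@cvg_pair _ _ _ (nbhs t) (nbhs (0 : R^o)) (nbhs t)).
      exact: cvg_cst.
    exact: cvg_id.
  exact: (cA N (open_nbhs_nbhs (conj oN Nz))).
have Gp : \forall u \near (t : R^o), gproj (G (0, u)) = gproj (F u).
  near=> u; have Ju : J u by near: u.
  have Nu : N (0, u) by near: u.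
  have [uFu cu] := uF u Ju; apply: (coset_eqP (uG _ Nu) uFu).1.
  by rewrite Gc.
exact: (koszul_comm0 (p := fun u => gproj (F u)) oN Nz uG sG Gp qp).
Unshelve. all: by end_near. Qed.

Lemma rp2_totally_geodesic : totally_geodesic S.
Proof.
move=> I c oI _ [sc Sc Hc]; split=> //; first by move=> t It; exact/rp2_Grass/Sc.
move=> t It N G oN sG uG Gc.
have [J0 [F [[oJ0 J0t] [sF uF]]]] := sc t It.
pose J := J0 `&` I; have oJ : open J by exact: openI.
have Jt : J t by split.
have cF : lift_on J c F.
  split; first by apply: smooth_mxW sF => u [].
  by move=> u [J0u _]; exact: uF.
have ScJ u : J u -> S (c u) by move=> [_ Iu]; exact: Sc.
have qp := geodesic_acc_commute oJ cF ScJ Jt (Hc t It).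
apply: (koszul_of_commute oJ Jt cF qp oN sG _ Gc).
by move=> z /uG[].
Qed.


(** ** Orbits of one-parameter groups *)

(** The commutator, written as a sum of products so that the rules for sums and
    products differentiate it. *)
Definition comm p (A B : 'M[C]_p) := A *m B + B *m (- A).

Lemma mulmx_conj p (U A B : 'M[C]_p) : U^H *m U = 1%:M ->
  (U *m A *m U^H) *m (U *m B *m U^H) = U *m (A *m B) *m U^H.
Proof.
by move=> UU; rewrite !mulmxA -[U *m A *m U^H *m U]mulmxA UU mulmx1.
Qed.

Lemma gprojK g : g \is unitarymx -> gproj g *m gproj g = gproj g.
Proof. by move=> ug; rewrite (mulmx_conj _ _ (unitaryl ug)) base_projK. Qed.

Lemma comm_conj p (U A B : 'M[C]_p) : U^H *m U = 1%:M ->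
  comm (U *m A *m U^H) (U *m B *m U^H) = U *m comm A B *m U^H.
Proof.
move=> UU; rewrite /comm mulmxN !mulmx_conj // !mulmxN.
by rewrite mulmxBr mulmxBl.
Qed.

Lemma genZ (r a b : R) : r *: gen a b = gen (r * a) (r * b).
Proof.
by apply/matrixP; apply: forall_ord3; apply: forall_ord3;
  rewrite !mxE /= ?mulr0 ?mulrN.
Qed.

(* The brackets of gen a b with e, up to order two. *)
Let sgen (a b : R) : 'M[R]_3 :=
  \matrix_(i, j) nth 0 (nth [::] [:: [:: 0; a; b]; [:: a; 0; 0]; [:: b; 0; 0]] i) j.

Let dgen (a b : R) : 'M[R]_3 :=
  \matrix_(i, j) nth 0 (nth [::] [:: [:: - (a ^+ 2 + b ^+ 2); 0; 0];
    [:: 0; a ^+ 2; a * b]; [:: 0; a * b; b ^+ 2]] i) j.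

Let gen_bracket (a b : R) : gen a b *m e - e *m gen a b = sgen a b.
Proof.
by apply/matrixP; apply: forall_ord3; apply: forall_ord3;
  rewrite !mxE !big_ord_recl !big_ord0 !mxE /=; ring.
Qed.

Let gen_sbracket (a b : R) :
  gen a b *m sgen a b - sgen a b *m gen a b = dgen a b + dgen a b.
Proof.
by apply/matrixP; apply: forall_ord3; apply: forall_ord3;
  rewrite !mxE !big_ord_recl !big_ord0 !mxE /=; ring.
Qed.

Let dgen_base_comm (a b : R) : dgen a b *m e = e *m dgen a b.
Proof.
by apply/matrixP; apply: forall_ord3; apply: forall_ord3;
  rewrite !mxE !big_ord_recl !big_ord0 !mxE /=; ring.
Qed.

Lemma comm_frame Q Q' : comm (T Q) (T Q') = T (Q *m Q' - Q' *m Q).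
Proof. by rewrite /comm mulmxN !(frame_mxM LL) frame_mxB. Qed.

(** As A is skew-Hermitian, F' = A F gives P' = [A, P], and differentiating once
    more P'' = [A, P'] = [A, [A, P]]. *)
Lemma Dmx2_one_param (F : R^o -> 'M[C]_(n + m)) (A : 'M[C]_(n + m)) t :
  (forall x, is_Dmx x (1 : R^o) F (A *m F x)) -> A^H = - A ->
  Dmx (Dmx (fun u => gproj (F u)) 1) 1 t = comm A (comm A (gproj (F t))).
Proof.
move=> dF AH; pose p u := gproj (F u).
have dp x : is_Dmx x (1 : R^o) p (comm A (p x)).
  apply: is_Dmx_eq (is_Dmx_gproj (dF x)) _.
  by rewrite adjmxM AH /comm /p /gproj !mulmxA.
have -> : Dmx p 1 = fun x => comm A (p x) by apply/funext => x; exact: is_DmxE (dp x).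
apply: is_DmxE; apply: is_Dmx_eq (is_DmxD (is_DmxM (is_Dmx_cst _ _ A) (dp t))
  (is_DmxM (dp t) (is_Dmx_cst _ _ (- A)))) _.
by rewrite mul0mx add0r mulmx0 addr0.
Qed.

Section Geodesic.
Variables (r f : R).
Local Notation b := (gen (cos f) (sin f)).

Let bT : b^T = - b. Proof. exact: tr_gen. Qed.
Let b3 : b *m b *m b = - b. Proof. by apply: gen3; rewrite cos2Dsin2. Qed.

(** The one-parameter group whose orbit of the base point is the geodesic with
    initial velocity r (cos f, sin f). *)
Definition one_param (u : R^o) : 'M[C]_(n + m) := K (rotmx b (r *: u)).

Let lE (h : R) (v x : R^o) : r *: (h *: v + x) = h *: (r *: v) + r *: x.
Proof. by rewrite scalerDr !scalerA mulrC. Qed.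

Let dl (x : R^o) : differentiable (fun u : R^o => r *: u : R^o) x.
Proof. by apply: differentiableZ; exact: ex_diff. Qed.

Lemma one_param0 : one_param 0 = 1%:M.
Proof. by rewrite /one_param scaler0 rotmx0 frame_act1. Qed.

Lemma smooth_one_param D : open D -> smooth_mx D one_param.
Proof. exact: (smooth_rotmx _ lE dl). Qed.

Lemma is_Dmx_one_param x :
  is_Dmx x (1 : R^o) one_param ((r%:C *: T b) *m one_param x).
Proof.
apply: is_Dmx_eq (is_Dmx_rotmx LL lE dl x 1 b3) _.
by rewrite -scalemxAl; congr (_%:C *: _); exact: mulr1.
Qed.

Lemma one_param_rot u : rotmx b (r *: u) *m (rotmx b (r *: u))^T = 1%:M.
Proof. exact: rotmx_orth. Qed.

Lemma one_param_lift k : k *m k^T = 1%:M ->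
  lift_on setT (fun u => coset (K k *m one_param u)) (fun u => K k *m one_param u).
Proof.
move=> kk; split.
  apply: smooth_mxM; [exact: openT|exact: smooth_mx_cst|].
  exact: smooth_one_param openT.
move=> u _; split => //.
exact: unitaryM (frame_unitary kk) (frame_unitary (one_param_rot u)).
Qed.

Lemma rp2_one_param k u : k *m k^T = 1%:M -> S (coset (K k *m one_param u)).
Proof.
move=> kk; have uu := one_param_rot u.
apply: rp2_act kk (frame_unitary uu) _.
by exists (rotmx b (r *: u)).
Qed.

(** Let b0 be the generator and U(t) = k exp (t b0). Then P = U E U^* and
    P'' = U [b0, [b0, E]] U^*. As b0 is in m, [b0, E] is off-diagonal and
    [b0, [b0, E]] is block diagonal, hence commutes with E. *)
Lemma geodesic_one_param k : k *m k^T = 1%:M ->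
  geodesic S setT (fun u => coset (K k *m one_param u)).
Proof.
move=> kk; have lk := one_param_lift kk; split.
- move=> x _; exists setT, (fun u => K k *m one_param u); split => //.
  by split=> //; exact: openT.
- by move=> u _; exact: rp2_one_param.
move=> t _ N G oN sG uG Gc.
apply: (koszul_of_commute openT I lk _ oN sG _ Gc); last by move=> z /uG[].
have ukk := frame_unitary kk.
pose b0 := r%:C *: T b; pose A := K k *m b0 *m (K k)^H.
have b0T : b0 = T (r *: b) by rewrite frame_mxZ.
have AH : A^H = - A.
  rewrite /A !adjmxM adjmxK b0T adj_frame_mx linearZ /= bT scalerN frame_mxN.
  by rewrite mulNmx mulmxN mulmxA.
have dG x : is_Dmx x (1 : R^o) (fun u => K k *m one_param u)
    (A *m (K k *m one_param x)).
  apply: is_Dmx_eq (is_DmxM (is_Dmx_cst _ _ _) (is_Dmx_one_param x)) _.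
  by rewrite mul0mx add0r /A -/b0 !mulmxA -(mulmxA _ _ (K k)) (unitaryl ukk) mulmx1.
rewrite (Dmx2_one_param t dG AH).
set U := K k *m one_param t.
have uU : U \is unitarymx := unitaryM ukk (frame_unitary (one_param_rot t)).
have AU : A = U *m b0 *m U^H.
  have cb : one_param t *m b0 = b0 *m one_param t.
    rewrite b0T /one_param (frame_actl LL) (frame_actr LL); congr (T _).
    by rewrite -scalemxAr -scalemxAl rotmxC.
  rewrite /A /U adjmxM -(mulmxA (K k) (one_param t) b0) cb !mulmxA.
  by rewrite -(mulmxA _ (one_param t) (one_param t)^H) (unitaryr (frame_unitary (one_param_rot t))) mulmx1.
rewrite AU /gproj !(comm_conj _ _ (unitaryl uU)).
set Z := comm b0 (comm b0 E).
have ZE : Z *m E = E *m Z.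
  rewrite /Z b0T -frame_base !comm_frame !(frame_mxM LL); congr (T _).
  by rewrite genZ gen_bracket gen_sbracket; rewrite mulmxDl mulmxDr dgen_base_comm.
by rewrite !(mulmx_conj _ _ (unitaryl uU)) ZE.
Qed.

End Geodesic.

(** ** Tangent spaces and completeness *)

Definition translate k (s : set 'M[C]_(n + m)) : set 'M[C]_(n + m) :=
  [set K k *m x | x in s].

Lemma translate_coset k g : translate k (coset g) = coset (K k *m g).
Proof.
apply/seteqP; split=> [_ [_ [h ih <-] <-]|_ [h ih <-]].
  by exists h => //; rewrite mulmxA.
by exists (g *m h); [exists h|rewrite mulmxA].
Qed.

Lemma rp2_translate k s : k *m k^T = 1%:M -> S s -> S (translate k s).
Proof.
move=> kk [k' kk' <-]; rewrite translate_coset.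
by apply: rp2_act kk (frame_unitary kk') _; exists k'.
Qed.

Lemma mpart_conj h (A : 'M[C]_(n + m)) : isotropy h ->
  mpart (h^H *m A *m h) = h^H *m mpart A *m h.
Proof.
move=> /isotropyP[uh hE].
have hE' : E *m h^H = h^H *m E.
  by rewrite -[E in LHS]adj_base_proj -adjmxM hE adjmxM adj_base_proj.
have hJ : h *m base_sym R n m = base_sym R n m *m h.
  by rewrite /base_sym mulmxBr mulmxBl mulmxDr mulmxDl hE mulmx1 mul1mx.
have -> : mpart (h^H *m A *m h) = h^H *m (A *m E - E *m A) *m h *m base_sym R n m.
  rewrite mpart_comm; refine (congr1 (mulmx^~ _) _).
  by rewrite mulmxBr mulmxBl !mulmxA hE' -!mulmxA hE.
by rewrite -mulmxA hJ mulmxA mpart_comm !mulmxA.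
Qed.

(** The group moves curves together with their lifts. The right factor h changes
    the representative of the point, which conjugates the velocity. *)
Lemma has_velocity_translate c (t : R^o) g A k h :
  k *m k^T = 1%:M -> isotropy h -> has_velocity c t g A ->
  has_velocity (fun u => translate k (c u)) t (K k *m g *m h) (h^H *m A *m h).
Proof.
move=> kk ih [N [F [oN [sF uF] Fg ->]]].
have uk := frame_unitary kk; have /isotropyP[uh hE] := ih.
have sG : smooth_mx N (fun u => K k *m F u *m h).
  have [oN' _] := oN; apply: smooth_mxM => //; last exact: smooth_mx_cst.
  by apply: smooth_mxM => //; exact: smooth_mx_cst.
exists N, (fun u => K k *m F u *m h); split; [exact: oN| |by rewrite Fg|].
  split; first exact: sG.
  move=> u Nu; have [uFu cu] := uF u Nu; split.
    exact: unitaryM (unitaryM uk uFu) uh.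
  by rewrite cu translate_coset (coset_isotropy _ ih).
have [_ Nt] := oN; have dF := smooth_is_Dmx (1 : R^o) sF Nt.
have dG := is_DmxM (is_DmxM (is_Dmx_cst t (1 : R^o) (K k)) dF) (is_Dmx_cst t (1 : R^o) h).
rewrite !mc_adj -(mpart_conj _ ih); refine (congr1 (@mpart R n m) _).
rewrite (is_DmxE dG) mul0mx add0r mulmx0 addr0 !adjmxM !mulmxA.
by rewrite -(mulmxA _ (K k)^H) (unitaryl uk) mulmx1.
Qed.

Lemma tangent_space_translate g A k h :
  k *m k^T = 1%:M -> isotropy h -> tangent_space S g A ->
  tangent_space S (K k *m g *m h) (h^H *m A *m h).
Proof.
move=> kk ih [c [vc Sc]]; exists (fun u => translate k (c u)); split.
  exact: has_velocity_translate kk ih vc.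
by apply: filterS Sc => u; exact: rp2_translate.
Qed.

Lemma mpart_gen (a b : R) : mpart (T (gen a b)) = T (gen a b).
Proof.
rewrite frame_gen /mpart /hat !scale_block_mx !add_block_mx !scaler0 !addr0.
by rewrite block_mxKur block_mxKdl.
Qed.

Lemma velocity_one_param (r f : R) :
  has_velocity (fun u => coset (one_param r f u)) 0 1%:M
    (T (gen (r * cos f) (r * sin f))).
Proof.
exists setT, (one_param r f); split.
- by split=> //; exact: openT.
- split; first exact: smooth_one_param openT.
  by move=> u _; split=> //; exact: frame_unitary (one_param_rot r f u).
- exact: one_param0.
rewrite mc_adj (is_DmxE (is_Dmx_one_param r f 0)) one_param0 adjmx1 mul1mx mulmx1.
by rewrite -frame_mxZ genZ mpart_gen.
Qed.

Lemma polar (a b : R) : exists r f, a = r * cos f /\ b = r * sin f.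
Proof.
pose r := Num.sqrt (a ^+ 2 + b ^+ 2).
have r2 : r ^+ 2 = a ^+ 2 + b ^+ 2 by rewrite sqr_sqrtr // addr_ge0 ?sqr_ge0.
have [r0|r0] := eqVneq r 0.
  exists 0, 0; rewrite !mul0r; move: r2; rewrite r0 expr0n /= => /esym/eqP.
  by rewrite paddr_eq0 ?sqr_ge0 // !sqrf_eq0 => /andP[/eqP -> /eqP ->].
have rp : 0 < r by rewrite lt_def r0 sqrtr_ge0.
have a1 : -1 <= a / r <= 1.
  rewrite -ler_norml normrM normfV (gtr0_norm rp) ler_pdivrMr // mul1r.
  rewrite -(@ler_pXn2r _ 2) ?nnegrE ?normr_ge0 ?(ltW rp) //.
  by rewrite real_normK ?num_real // r2 lerDl sqr_ge0.
have ca : cos (acos (a / r)) = a / r by rewrite acosK // in_itv.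
have sa : sin (acos (a / r)) = `|b| / r.
  rewrite sin_acos // -[X in Num.sqrt X](_ : (`|b| / r) ^+ 2 = _).
    by rewrite sqrtr_sqr normrM normfV normr_id (gtr0_norm rp).
  rewrite !expr_div_n real_normK ?num_real // -[b ^+ 2](addKr (a ^+ 2)) -r2.
  by field.
have [b0|b0] := leP 0 b.
  exists r, (acos (a / r)); rewrite ca sa ger0_norm //.
  by split; field.
exists r, (- acos (a / r)); rewrite cosN sinN ca sa ltr0_norm //.
by split; field.
Qed.

(** The equation Q = Q e + e Q says that Q is tangent at e to the rank one
    projections: only its first row and column survive, off the corner. The left
    side is the product of Q by the reflection 2 e - 1. *)
Lemma tangent_gen Q : Q^T = Q -> Q = Q *m e + e *m Q ->
  Q *m e + Q *m e - Q =
  gen (Q (lift ord0 ord0) ord0) (Q (lift ord0 (lift ord0 ord0)) ord0).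
Proof.
move=> QT QE; have Qs i j : Q i j = Q j i by rewrite -[in LHS]QT mxE.
have Qij i j : Q i j = (Q *m e + e *m Q) i j by rewrite -QE.
apply/matrixP => i j; move: (Qij i j) (Qs i j); move: i j.
by apply: forall_ord3; apply: forall_ord3;
  rewrite !mxE !big_ord_recl !big_ord0 !mxE /= => h1 h2; lra.
Qed.

(** A curve of S through the base point has a derivative P' that is symmetric in
    the frame and satisfies P' = P' E + E P', by differentiation of P P = P;
    [tangent_gen] concludes. Conversely every vector of the span is the velocity
    of a one-parameter group. *)
Lemma tangent_space_rp2 : tangent_space S 1%:M = spanR (hat X) (hat Y).
Proof.
apply/seteqP; split=> [A [c [[N [F [[oN N0] [sF uF] F0 AE]]] Sc]]|A [a [b ->]]].
  have [J0 [oJ0 J00] J0S] : exists2 J0, open_nbhs (0 : R^o) J0 & J0 `<=` [set u | S (c u)].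
    by move: Sc; rewrite /prop_near1 nbhsE => -[J0 oJ0 J0S]; exists J0.
  pose J := N `&` J0; have oJ : open J by exact: openI.
  have Jz : J 0 by [].
  have uJ : unitary_on J F by move=> u [/uF[]].
  have sJ : smooth_mx J F by apply: smooth_mxW sF => u [].
  pose p u := gproj (F u).
  have sp : smooth_mx J p by exact: smooth_gproj.
  have pT u : J u -> p u = T (frame_coef frame (p u)).
    move=> Ju; apply: rp2_in_frame (uJ u Ju) _.
    by have [Nu J0u] := Ju; have [_ <-] := uF u Nu; exact: J0S.
  have dp := smooth_is_Dmx (1 : R^o) sp Jz.
  have qT := Dmx_rp2_in_frame (1 : R^o) oJ sp pT Jz.
  have qH := Dmx_hermitian (1 : R^o) oJ sp (fun u _ => adj_gproj (F u)) Jz.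
  set q := Dmx p 1 0 in dp qT qH.
  have p0 : p 0 = T e by rewrite /p F0 gproj1 frame_base.
  have qE : q = q *m T e + T e *m q.
    have := is_DmxM dp dp; rewrite p0 => /is_DmxE <-; apply: eq_Dmx oJ _ _ Jz.
    by move=> u Ju; exact: esym (gprojK (uJ u Ju)).
  pose Q := frame_coef frame q.
  have QT : Q^T = Q by exact: frame_coef_sym.
  have QE : Q = Q *m e + e *m Q.
    rewrite -[LHS](frame_coefK LL) // -qT qE {1 2}qT !(frame_mxM LL) -frame_mxD.
    by rewrite (frame_coefK LL).
  exists (Q (lift ord0 ord0) ord0), (Q (lift ord0 (lift ord0 ord0)) ord0).
  rewrite -frame_gen AE (mcE _ oJ Jz uJ sJ) F0 adjmx1 mul1mx mulmx1 -/q qT -/Q.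
  rewrite /base_sym -frame_base mulmxBr mulmx1 mulmxDr !(frame_mxM LL).
  rewrite -frame_mxD -frame_mxB; congr (T _).
  exact: tangent_gen QT QE.
have [r [f [-> ->]]] := polar a b.
exists (fun u => coset (one_param r f u)); split.
  by rewrite -frame_gen; exact: velocity_one_param.
near=> u; rewrite -[one_param r f u]mul1mx -(frame_act1 frame).
by apply: rp2_one_param; rewrite trmx1 mulmx1.
Unshelve. all: by end_near. Qed.

(** By homogeneity the point can be moved to the base point, where the geodesics
    are the orbits of one-parameter groups. *)
Lemma rp2_complete : complete S.
Proof.
move=> g A ug Sg tA.
have [k kk kg] := Sg.
have := coset_mem (K k); rewrite kg => -[h ih hE].
have [uh _] := (isotropyP h).1 ih.
have kk' : k^T *m k^T^T = 1%:M by rewrite trmxK; exact: mulmx1C.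
have := tangent_space_translate kk' ih tA.
have -> : K k^T *m g *m h = 1%:M.
  by rewrite -mulmxA hE -adj_frame_act (unitaryl (frame_unitary kk)).
rewrite tangent_space_rp2 => -[a [b AE]].
have [r [f [ar br]]] := polar a b.
exists (fun u => coset (K k *m one_param r f u)); split.
  exact: geodesic_one_param.
have ihV := isotropyV ih.
have := has_velocity_translate kk ihV (velocity_one_param r f).
have -> : (fun u => translate k (coset (one_param r f u))) =
    (fun u => coset (K k *m one_param r f u)).
  by apply/funext => u; rewrite translate_coset.
have -> : K k *m 1%:M *m h^H = g by rewrite mulmx1 -hE -mulmxA (unitaryr uh) mulmx1.
suff -> : h^H^H *m T (gen (r * cos f) (r * sin f)) *m h^H = A by [].
rewrite -ar -br frame_gen -AE adjmxK.
by rewrite !mulmxA (unitaryr uh) mul1mx -mulmxA (unitaryr uh) mulmx1.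
Qed.


(** ** Longitude and latitude *)

Section Charts.
Local Notation i1 := (lift ord0 ord0 : 'I_3).
Local Notation i2 := (lift ord0 (lift ord0 ord0) : 'I_3).
Local Notation b1 := (gen 1 0 : 'M[R]_3).
Local Notation b2 := (gen 0 1 : 'M[R]_3).

Lemma rotmx1E t : rotmx b1 t = \matrix_(i, j) nth 0 (nth [::]
  [:: [:: cos t; - sin t; 0]; [:: sin t; cos t; 0]; [:: 0; 0; 1]] i) j.
Proof.
by apply/matrixP; apply: forall_ord3; apply: forall_ord3;
  rewrite !mxE !big_ord_recl !big_ord0 !mxE /=; ring.
Qed.

Lemma rotmx2E t : rotmx b2 t = \matrix_(i, j) nth 0 (nth [::]
  [:: [:: cos t; 0; - sin t]; [:: 0; 1; 0]; [:: sin t; 0; cos t]] i) j.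
Proof.
by apply/matrixP; apply: forall_ord3; apply: forall_ord3;
  rewrite !mxE !big_ord_recl !big_ord0 !mxE /=; ring.
Qed.

Let b1T : b1^T = - b1. Proof. exact: tr_gen. Qed.
Let b2T : b2^T = - b2. Proof. exact: tr_gen. Qed.
Let b13 : b1 *m b1 *m b1 = - b1. Proof. by apply: gen3; rewrite expr1n expr0n addr0. Qed.
Let b23 : b2 *m b2 *m b2 = - b2. Proof. by apply: gen3; rewrite expr1n expr0n add0r. Qed.

(** The rotation that carries the first vector e_0 of the basis of R^3 to the point of
    the unit sphere with longitude z.1 and latitude z.2. *)
Definition sph (z : plane R) : 'M[R]_3 := rotmx b1 z.1 *m rotmx b2 z.2.

Lemma orthM k k' : k *m k^T = 1%:M -> k' *m k'^T = 1%:M ->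
  (k *m k') *m (k *m k')^T = 1%:M.
Proof.
by move=> kk kk'; rewrite trmx_mul mulmxA -(mulmxA k) kk' mulmx1.
Qed.

Lemma sph_orth z : sph z *m (sph z)^T = 1%:M.
Proof. by apply: orthM; exact: rotmx_orth. Qed.

Lemma sph0 : sph (0, 0) = 1%:M.
Proof. by rewrite /sph !rotmx0 mulmx1. Qed.

(** The projection onto the line spanned by the first column of k. *)
Lemma outerE k i j : (k *m e *m k^T) i j = k i ord0 * k j ord0.
Proof.
rewrite mxE (bigD1 ord0) //= big1 ?addr0 => [|l l0]; rewrite mxE.
  rewrite (bigD1 ord0) //= big1 ?addr0 => [|l l0]; rewrite !mxE.
    by rewrite eqxx mulr1.
  by rewrite (negbTE l0) mulr0.
by rewrite big1 ?mul0r // => s _; rewrite !mxE (negbTE l0) andbF mulr0.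
Qed.

Lemma orth_col k : k *m k^T = 1%:M ->
  k ord0 ord0 ^+ 2 + k i1 ord0 ^+ 2 + k i2 ord0 ^+ 2 = 1.
Proof.
move=> /mulmx1C /(congr1 (fun A : 'M[R]_3 => A ord0 ord0)).
rewrite !mxE !big_ord_recl big_ord0 !mxE /= mulr1n => h.
by rewrite -[RHS]h; ring.
Qed.

Lemma sph_col z : [/\ sph z ord0 ord0 = cos z.1 * cos z.2,
  sph z i1 ord0 = sin z.1 * cos z.2 & sph z i2 ord0 = sin z.2].
Proof.
by rewrite /sph rotmx1E rotmx2E; split;
  rewrite !mxE !big_ord_recl !big_ord0 !mxE /=; ring.
Qed.

Definition box : set (plane R) :=
  [set z | - (pi / 2) < z.1 < pi / 2 /\ - (pi / 2) < z.2 < pi / 2].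

Lemma open_box : open box.
Proof.
have oI : open [set x : R^o | - (pi / 2) < x < pi / 2].
  rewrite (_ : [set x | _] = `](- (pi / 2) : R), (pi / 2)[%classic).
    exact: itv_open.
  by apply/seteqP; split=> x /=; rewrite in_itv.
apply: openI.
  by apply: (open_comp (f := fst : plane R -> R^o) _ oI) => z _; exact: cvg_fst.
by apply: (open_comp (f := snd : plane R -> R^o) _ oI) => z _; exact: cvg_snd.
Qed.

(** The inverse of [sph]. The line spanned by w is known through w w^T; when
    w_0 <> 0, tan z.1 = w_1 / w_0 and tan z.2 = (w_2 / w_0) cos z.1. *)
Definition lon_lat Q : plane R :=
  let x := atan (Q i1 ord0 / Q ord0 ord0) in
  (x, atan (Q i2 ord0 / Q ord0 ord0 * cos x)).

Lemma lon_lat_box Q : box (lon_lat Q).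
Proof.
have ab (a : R) : - (pi / 2) < atan a < pi / 2 by case: (atan_def a).
by split; exact: ab.
Qed.

Lemma cvg_lon_lat (U : Type) (F : set_system U) (FF : Filter F)
    (Q : U -> 'M[R]_3) (Q0 : 'M[R]_3) :
  (forall i j, Q u i j @[u --> F] --> (Q0 i j : R^o)) -> Q0 ord0 ord0 != 0 ->
  lon_lat (Q u) @[u --> F] --> lon_lat Q0.
Proof.
move=> c Q00; rewrite /lon_lat.
have c1 : (atan (Q u i1 ord0 / Q u ord0 ord0) : R^o) @[u --> F] -->
    (atan (Q0 i1 ord0 / Q0 ord0 ord0) : R^o).
  rewrite -[Q0 i1 ord0 / _]mulr1.
  have -> : (fun u => atan (Q u i1 ord0 / Q u ord0 ord0)) =
      (fun u => atan (Q u i1 ord0 / Q u ord0 ord0 * cst 1 u)).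
    by apply/funext => u; rewrite mulr1.
  by apply: cvg_atan_ratio => //; exact: cvg_cst.
apply: (@cvg_pair _ _ _ F (nbhs (atan (Q0 i1 ord0 / Q0 ord0 ord0) : R^o)) (nbhs
  (atan (Q0 i2 ord0 / Q0 ord0 ord0 * cos (atan (Q0 i1 ord0 / Q0 ord0 ord0))) : R^o))).
  exact: c1.
apply: cvg_atan_ratio => //.
by apply: (@continuous_cvg _ _ _ _ _ _ (cos : R^o -> R^o)) => //; exact: continuous_cos.
Qed.

Lemma sphK z : box z -> lon_lat (sph z *m e *m (sph z)^T) = z.
Proof.
case: z => x y [/= xb yb]; rewrite /lon_lat !outerE.
have [-> -> ->] := sph_col (x, y); rewrite /=.
have cx := cos_gt0_pihalf xb; have cy := cos_gt0_pihalf yb.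
have nx : cos x != 0 by rewrite gt_eqF.
have ny : cos y != 0 by rewrite gt_eqF.
have -> : sin x * cos y * (cos x * cos y) / (cos x * cos y * (cos x * cos y)) = tan x.
  by rewrite /tan; field; rewrite nx ny.
rewrite tanK ?in_itv //.
have -> : sin y * (cos x * cos y) / (cos x * cos y * (cos x * cos y)) * cos x = tan y.
  by rewrite /tan; field; rewrite nx ny.
by rewrite tanK ?in_itv.
Qed.

(** On the box the cosines are positive, so the point of the sphere with these
    coordinates is l w for some l; both being unit vectors, l^2 = 1. *)
Lemma lon_latK k : k *m k^T = 1%:M -> k ord0 ord0 != 0 ->
  let z := lon_lat (k *m e *m k^T) in
  sph z *m e *m (sph z)^T = k *m e *m k^T.
Proof.
move=> /orth_col kk k0 z.
have [/= xb yb] := lon_lat_box (k *m e *m k^T); rewrite -/z in xb yb.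
have cx := cos_gt0_pihalf xb; have cy := cos_gt0_pihalf yb.
have nx : cos z.1 != 0 by rewrite gt_eqF.
have ny : cos z.2 != 0 by rewrite gt_eqF.
have [s0 s1 s2] := sph_col z.
have tx : tan z.1 = k i1 ord0 / k ord0 ord0.
  by rewrite /z /lon_lat /= atanK !outerE; field.
have ty : tan z.2 = k i2 ord0 / k ord0 ord0 * cos z.1.
  by rewrite {1}/z /lon_lat /= atanK !outerE -/(lon_lat _).1; congr (_ * _); field.
have sx : sin z.1 = cos z.1 * (k i1 ord0 / k ord0 ord0) by rewrite -tx /tan; field.
have sy : sin z.2 = cos z.2 * (k i2 ord0 / k ord0 ord0 * cos z.1).
  by rewrite -ty /tan; field.
pose l := cos z.1 * cos z.2 / k ord0 ord0.
have sl i : sph z i ord0 = l * k i ord0.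
  move: i; apply: forall_ord3; rewrite ?s0 ?s1 ?s2 ?sx ?sy /l; field => //.
have l2 : l ^+ 2 = 1.
  have := orth_col (sph_orth z); rewrite !sl !exprMn -!mulrDr kk mulr1.
  by [].
apply/matrixP => i j; rewrite !outerE !sl.
by rewrite mulrACA -expr2 l2 mul1r.
Qed.

Definition chart k (z : plane R) : 'M[C]_(n + m) := K k *m K (sph z).

Let fstE (h : R) (v x : plane R) : (h *: v + x).1 = h *: v.1 + x.1. Proof. by []. Qed.
Let sndE (h : R) (v x : plane R) : (h *: v + x).2 = h *: v.2 + x.2. Proof. by []. Qed.

Lemma chartE k z : chart k z = K k *m (K (rotmx b1 z.1) *m K (rotmx b2 z.2)).
Proof. by rewrite /chart /sph (frame_actM LL). Qed.

Lemma smooth_chart k D : open D -> smooth_mx D (chart k).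
Proof.
move=> oD; rewrite (funext (chartE k)).
apply: smooth_mxM => //; first exact: smooth_mx_cst.
apply: smooth_mxM => //.
  exact: (smooth_rotmx frame fstE differentiable_fst).
exact: (smooth_rotmx frame sndE differentiable_snd).
Qed.

Lemma chart_unitary k z : k *m k^T = 1%:M -> chart k z \is unitarymx.
Proof. by move=> kk; exact: unitaryM (frame_unitary kk) (frame_unitary (sph_orth z)). Qed.

Lemma rp2_chart k z : k *m k^T = 1%:M -> S (coset (chart k z)).
Proof.
move=> kk; exists (k *m sph z); first exact: orthM kk (sph_orth z).
by rewrite /chart (frame_actM LL).
Qed.

(** The Maurer-Cartan form of a product U A B in which the logarithmic derivatives
    D and F of A and B commute with A and B. *)
Lemma adj_mul_derivative p (U A B D F : 'M[C]_p) (a b : C) :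
  U^H *m U = 1%:M -> A^H *m A = 1%:M -> B^H *m B = 1%:M ->
  D *m A = A *m D -> F *m B = B *m F ->
  (U *m (A *m B))^H *m (U *m (a *: (D *m A) *m B + A *m (b *: (F *m B)))) =
  a *: (B^H *m D *m B) + b *: F.
Proof.
move=> UU AA BB DA FB; rewrite !adjmxM mulmxA -(mulmxA _ U^H U) UU mulmx1.
rewrite DA FB mulmxDr -scalemxAl -!scalemxAr.
by congr (_ *: _ + _ *: _); rewrite !mulmxA -(mulmxA B^H A^H A) AA mulmx1 // BB mul1mx.
Qed.

Lemma mc_chart k z v : k *m k^T = 1%:M ->
  (chart k z)^H *m Dmx (chart k) v z =
  T (v.1 *: ((rotmx b2 z.2)^T *m b1 *m rotmx b2 z.2) + v.2 *: b2).
Proof.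
move=> kk; have d1 := is_Dmx_rotmx LL fstE differentiable_fst z v b13.
have d2 := is_Dmx_rotmx LL sndE differentiable_snd z v b23.
have d3 := is_DmxM (is_Dmx_cst z v (K k)) (is_DmxM d1 d2).
rewrite (funext (chartE k)) (is_DmxE d3) mul0mx add0r.
have uA := unitaryl (frame_unitary (rotmx_orth b1T b13 z.1)).
have uB := unitaryl (frame_unitary (rotmx_orth b2T b23 z.2)).
have cA : T b1 *m K (rotmx b1 z.1) = K (rotmx b1 z.1) *m T b1.
  by rewrite (frame_actr LL) (frame_actl LL) rotmxC.
have cB : T b2 *m K (rotmx b2 z.2) = K (rotmx b2 z.2) *m T b2.
  by rewrite (frame_actr LL) (frame_actl LL) rotmxC.
rewrite (adj_mul_derivative _ _ (unitaryl (frame_unitary kk)) uA uB cA cB).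
rewrite frame_mxD !frame_mxZ; congr (_ *: _ + _).
by rewrite adj_frame_act (frame_actl LL) (frame_actr LL).
Qed.

Lemma base_comm_col Q i : Q *m e = e *m Q -> i != ord0 -> Q i ord0 = 0.
Proof.
move=> QE i0; have := congr1 (fun A : 'M[R]_3 => A i ord0) QE.
rewrite /= mxE (bigD1 ord0) //= big1 ?addr0 => [|l l0]; last first.
  by rewrite [delta_mx _ _ _ _]mxE (negbTE l0) mulr0.
rewrite [delta_mx _ _ _ _]mxE !eqxx mulr1 => ->.
by rewrite mxE big1 // => l _; rewrite mxE (negbTE i0) mul0r.
Qed.

(** The m-component of the Maurer-Cartan form is
    (v.1 cos z.2) hat X + v.2 hat Y, and cos z.2 > 0. *)
Lemma chart_immersion k z v : k *m k^T = 1%:M -> box z ->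
  mc (chart k) v z = 0 -> v = 0.
Proof.
move=> kk zb; rewrite mc_adj (mc_chart _ _ kk); set Z := _ + _ => Z0.
have ZE : Z *m e = e *m Z.
  apply: (can_inj (fun Q => frame_coefK LL Q n0)).
  rewrite -!(frame_mxM LL) frame_base.
  apply/eqP; rewrite -subr_eq0; apply/eqP.
  by rewrite -[LHS]mulmx1 -base_symK mulmxA -mpart_comm Z0 mul0mx.
have Zi := base_comm_col ZE.
have [_ /= yb] := zb; have cy := cos_gt0_pihalf yb.
have e1 : v.1 * cos z.2 = 0.
  rewrite -(Zi i1) // /Z rotmx2E !mxE !big_ord_recl !big_ord0 !mxE
    !big_ord_recl !big_ord0 !mxE /=; ring.
have v1 : v.1 = 0 by move/eqP: e1; rewrite mulf_eq0 (gt_eqF cy) orbF => /eqP.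
have v2 : v.2 = 0.
  by have := Zi i2 isT; rewrite /Z v1 scale0r add0r !mxE /= mulr1.
by move: v1 v2; case: (v) => a b /= -> ->.
Qed.

(** The coefficients of the point g after K k has been moved to the base point;
    [lon_lat] reads its coordinates off them. *)
Definition chart_coef k g : 'M[R]_3 := frame_coef frame ((K k)^H *m gproj g *m K k).

Lemma chart_coefE k k' g : k *m k^T = 1%:M ->
  gproj g = T (k' *m e *m k'^T) ->
  chart_coef k g = (k^T *m k') *m e *m (k^T *m k')^T.
Proof.
move=> kk gk; rewrite /chart_coef gk adj_frame_act (frame_actl LL) (frame_actr LL).
by rewrite (frame_coefK LL) // trmx_mul trmxK !mulmxA.
Qed.

Lemma chart_coef_chart k z : k *m k^T = 1%:M ->
  chart_coef k (chart k z) = sph z *m e *m (sph z)^T.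
Proof.
move=> kk; rewrite (chart_coefE (k' := k *m sph z) kk).
  by rewrite mulmxA (mulmx1C kk) mul1mx.
by rewrite /chart -(frame_actM LL) gproj_frame.
Qed.

Lemma chart_coef_neq0 k x : k *m k^T = 1%:M -> box x ->
  chart_coef k (chart k x) ord0 ord0 != 0.
Proof.
move=> kk [/= xb1 xb2].
rewrite (chart_coef_chart _ kk) outerE; have [-> _ _] := sph_col x.
by rewrite !mulf_neq0 // gt_eqF // cos_gt0_pihalf.
Qed.

Lemma coset_chart k k' g : k *m k^T = 1%:M -> k' *m k'^T = 1%:M ->
  g \is unitarymx -> gproj g = T (k' *m e *m k'^T) ->
  chart_coef k g ord0 ord0 != 0 ->
  coset g = coset (chart k (lon_lat (chart_coef k g))).
Proof.
move=> kk kk' ug gk; rewrite (chart_coefE kk gk).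
set w := k^T *m k' => w0.
have ww : w *m w^T = 1%:M by apply: orthM => //; rewrite trmxK; exact: mulmx1C.
have w00 : w ord0 ord0 != 0.
  by move: w0; rewrite outerE mulf_eq0 negb_or => /andP[].
have E := lon_latK ww w00.
apply: (coset_eqP ug (chart_unitary _ kk)).2.
rewrite gk /chart gprojM gproj_frame (frame_act_conj LL) E /w trmx_mul trmxK.
by rewrite !mulmxA kk mul1mx -(mulmxA _ k) kk mulmx1.
Qed.

Lemma cvg_chart_coef k x i j :
  chart_coef k (of_parts A) i j @[A --> parts (chart k x)] -->
  (chart_coef k (chart k x) i j : R^o).
Proof.
have sg : smooth_mx setT (fun A : parts_space R (n + m) => gproj (of_parts A)).
  by apply: smooth_gproj; [exact: openT|exact: smooth_of_parts].
have s2 : smooth_mx setT (fun A : parts_space R (n + m) =>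
    (K k)^H *m gproj (of_parts A) *m K k).
  apply: smooth_mxM; [exact: openT| |exact: smooth_mx_cst].
  by apply: smooth_mxM; [exact: openT|exact: smooth_mx_cst|].
have c : {for parts (chart k x), continuous
    (fun A : parts_space R (n + m) => chart_coef k (of_parts A) i j : R^o)}.
  exact: (Ck_frame_coef frame 0 i j openT s2 _ I).
exact: (eq_ind _ (fun a : R^o =>
  chart_coef k (of_parts A) i j @[A --> parts (chart k x)] --> a) c _
  (congr1 (fun g => chart_coef k g i j) (partsK (chart k x)))).
Qed.

(** The coordinates are continuous functions of the real and imaginary parts of
    the entries of the matrix. *)
Lemma near_lon_lat k x W : k *m k^T = 1%:M -> box x -> nbhs x W ->
  \forall A \near parts (chart k x), W (lon_lat (chart_coef k (of_parts A))).
Proof.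
move=> kk xb nW.
have xE : x = lon_lat (chart_coef k (chart k x)).
  by rewrite (chart_coef_chart _ kk) sphK.
have q0 := chart_coef_neq0 kk xb.
have c := @cvg_lon_lat _ _ _ (fun A => chart_coef k (of_parts A)) _
  (@cvg_chart_coef k x) q0.
exact: c _ (eq_ind _ (fun a : plane R => nbhs a W) nW _ xE).
Qed.

Lemma is_chart_chart k : k *m k^T = 1%:M -> is_chart S box (chart k).
Proof.
move=> kk; split.
- exact: open_box.
- split; first exact: smooth_chart open_box.
  by move=> z _; split; [exact: chart_unitary|exact: rp2_chart].
- move=> x y xb yb /(coset_eqP (chart_unitary x kk) (chart_unitary y kk)).1 xy.
  rewrite -(sphK xb) -(sphK yb) -!(chart_coef_chart _ kk).
  by rewrite /chart_coef xy.
- by move=> x xb v; exact: chart_immersion.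
move=> x W xb nW.
pose Q A := chart_coef k (of_parts A : 'M[C]_(n + m)).
have q0 := chart_coef_neq0 kk xb.
have n1 : \forall A \near parts (chart k x), W (lon_lat (Q A)).
  exact: near_lon_lat kk xb nW.
have n2 : \forall A \near parts (chart k x), Q A ord0 ord0 != 0.
  exact: (cvgr_neq0 _ (@cvg_chart_coef k x ord0 ord0) q0).
have [d d0 dP] := nbhs_parts (filterI n1 n2).
exists d => // g ug Sg gx; have [] := dP g gx; rewrite /Q partsK => Wg g0.
have [k' kk' gk] := (rp2P ug).1 Sg.
exists (lon_lat (chart_coef k g)); split => //; first exact: lon_lat_box.
exact: coset_chart kk kk' ug gk g0.
Qed.

Lemma rotmx_gen_col (f t : R) : let k := rotmx (gen (cos f) (sin f)) t in
  [/\ k ord0 ord0 = cos t, k i1 ord0 = sin t * cos f & k i2 ord0 = sin t * sin f].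
Proof.
have s2 := sin2cos2 f; split; rewrite !mxE !big_ord_recl !big_ord0 !mxE /=; ring: s2.
Qed.

(** Every unit vector w of R^3 is, up to sign, cos r e_0 + sin r u with u a
    unit vector orthogonal to e_0: the great circle from e_0 in the direction u passes
    through the line of w at time r. *)
Lemma one_param_reach k k' : k *m k^T = 1%:M -> k' *m k'^T = 1%:M ->
  exists r f, coset (K k *m one_param r f 1) = coset (K k').
Proof.
move=> kk kk'; pose w := k^T *m k'.
have ww : w *m w^T = 1%:M by apply: orthM => //; rewrite trmxK; exact: mulmx1C.
have [p [f [w1 w2]]] := polar (w i1 ord0) (w i2 ord0).
have [q [r [w0 pE]]] := polar (w ord0 ord0) p.
have qq : q ^+ 2 = 1.
  rewrite -(orth_col ww) w0 w1 w2 pE.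
  rewrite -[LHS]mulr1 -[X in _ * X](cos2Dsin2 r).
  have := cos2Dsin2 f; move: (cos f) (sin f) => c s cs.
  rewrite !exprMn -addrA -mulrDr cs; ring.
exists r, f; rewrite /one_param -(frame_actM LL).
set h := rotmx _ _.
have hh : h *m h^T = 1%:M by exact: one_param_rot.
have kh := orthM kk hh.
apply: (coset_eqP (frame_unitary kh) (frame_unitary kk')).2.
have kE : k' = k *m w by rewrite mulmxA kk mul1mx.
have outerM A : (k *m A) *m e *m (k *m A)^T = k *m (A *m e *m A^T) *m k^T.
  by rewrite trmx_mul !mulmxA.
rewrite !gproj_frame kE !outerM; congr (T (k *m _ *m k^T)).
have [h0 h1 h2] := rotmx_gen_col f (r *: (1 : R^o)).
rewrite -/h [r *: _]mulr1 in h0 h1 h2.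
have wh i : w i ord0 = q * h i ord0.
  move: i; apply: forall_ord3; rewrite ?w0 ?w1 ?w2 ?h0 ?h1 ?h2 ?pE //; ring.
by apply/matrixP => i j; rewrite !outerE !wh mulrACA -expr2 qq mul1r.
Qed.

(** The chart centred at each point is the translate of the one at the base point,
    and great circles join any two points. *)
Lemma rp2_surface : surface S.
Proof.
split; first exact: rp2_Grass.
  move=> _ [k kk <-]; exists box, (chart k); split; first exact: is_chart_chart.
  exists (0, 0); last by rewrite /chart sph0 frame_act1 mulmx1.
  have p0 : 0 < pi / 2 :> R by rewrite divr_gt0 ?pi_gt0.
  by rewrite /box /= oppr_lt0 p0.
move=> _ _ [k kk <-] [k' kk' <-].
have [r [f rE]] := one_param_reach kk kk'.
exists (fun u => coset (K k *m one_param r f u)); split.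
- by have [] := geodesic_one_param r f kk.
- by move=> u; exact: rp2_one_param.
- by rewrite one_param0 mulmx1.
- exact: rE.
Qed.

End Charts.

Lemma rp2_base : S (coset 1%:M).
Proof. by exists 1%:M; rewrite /= ?frame_act1 // trmx1 mulmx1. Qed.

Theorem rp2_gives_rise : gives_rise (spanR (hat X) (hat Y)).
Proof.
exists S; split.
- exact: rp2_surface.
- exact: rp2_base.
- exact: rp2_complete.
- exact: rp2_totally_geodesic.
- exact: tangent_space_rp2.
Qed.

End Plane.

(** * Reduction to orthonormal X and Y *)

Section Normalization.
Variables (R : realType) (n m : nat).
Implicit Types (X Y : 'M[R[i]]_(m, n)).

Lemma hatD X Y : hat (X + Y) = hat X + hat Y.
Proof.
rewrite /hat add_block_mx !addr0; congr (block_mx _ _ _ _).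
by rewrite -opprD; congr (- _); exact: adjmxD.
Qed.

Lemma hatZ (a : R) X : hat (a%:C *: X) = a%:C *: hat X.
Proof.
rewrite /hat scale_block_mx !scaler0 scalerN; congr (block_mx _ _ _ _).
by congr (- _); exact: adjmxZ.
Qed.

Lemma spanR_recombine k (A B : 'M[R[i]]_k) (a b d : R) : a != 0 -> d != 0 ->
  spanR (a%:C *: A) (d%:C *: (B + b%:C *: A)) = spanR A B.
Proof.
move=> a0 d0; apply/seteqP; split=> _ [s [t ->]].
  exists (s * a + t * d * b), (t * d); apply/matrixP => i j.
  by rewrite !mxE !(rmorphD, rmorphM) /=; ring.
have [u uE] : exists u, t = u * d by exists (t / d); rewrite divfK.
have [r rE] : exists r, s = r * a + t * b.
  by exists ((s - t * b) / a); rewrite divfK // subrK.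
exists r, u; apply/matrixP => i j.
by rewrite rE uE !mxE !(rmorphD, rmorphM) /=; ring.
Qed.

(** If B is a multiple of A, the span is a line: two of its elements are always
    linearly dependent. *)
Lemma real_dim2_indep k (A B : 'M[R[i]]_k) (a : R) :
  real_dim2 (spanR A B) -> B <> a%:C *: A.
Proof.
move=> [P [Q [PQ E]]] BA.
have span1 D : spanR A B D -> exists c : R, D = c%:C *: A.
  move=> [s [t ->]]; exists (s + t * a).
  by rewrite BA scalerA -rmorphM -scalerDl -rmorphD.
have [|p pE] := span1 P.
  by rewrite E; exists 1, 0; rewrite scale1r scale0r addr0.
have [|q qE] := span1 Q.
  by rewrite E; exists 0, 1; rewrite scale1r scale0r add0r.
have [|q0 p0] := PQ q (- p).
  by rewrite pE qE !scalerA -!rmorphM -scalerDl -rmorphD mulNr mulrC subrr scale0r.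
have {}p0 : p = 0 by apply/eqP; rewrite -oppr_eq0 p0.
have [|/eqP] := PQ 1 0; last by rewrite oner_eq0.
by rewrite pE p0 !scale0r scaler0 addr0.
Qed.

End Normalization.

(** The scalar is a sum of squared moduli, the squared norm of a column of X. *)
Lemma Umn_sqr_norm (R : realType) (n m : nat) (X : 'M[R[i]]_(m, n)) :
  (0 < n)%N -> Umn X -> exists2 r : R, 0 < r & X^H *m X = (r ^+ 2)%:C%:M.
Proof.
move=> n0 [l l0 /= Xl]; have {}Xl : X^H *m X = l%:M by [].
pose i0 := Ordinal n0.
have lE : l = \sum_j `|X j i0| ^+ 2.
  have := congr1 (fun A : 'M[R[i]]_n => A i0 i0) Xl; rewrite !mxE eqxx mulr1n => <-.
  by apply: eq_bigr => j _; rewrite /adjmx !mxE mulrC -normCK.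
have l_ge0 : 0 <= l by rewrite lE; apply: sumr_ge0 => j _; rewrite exprn_ge0.
have lR : l = (complex.Re l)%:C by rewrite RRe_real // ger0_real.
have Rl : 0 < complex.Re l by rewrite -ltcR -lR lt_def l0.
exists (Num.sqrt (complex.Re l)); first by rewrite sqrtr_gt0.
by rewrite sqr_sqrtr ?(ltW Rl) // -lR.
Qed.

Theorem corollary3p5 (R : realType) (n m : nat) (X Y : 'M[R[i]]_(m, n))
    (hX : Umn X) (hY : Umn Y)
    (hdim : real_dim2 (spanR (hat X) (hat Y)))
    (hXY : exists mu : R, (X^t*%sesqui *m Y)%R = ((mu%:C)%C%:M)%R) :
  gives_rise (spanR (hat X) (hat Y)).
Proof.
have n0 : (0 < n)%N.
  case: n X Y hX hY hdim hXY => // X Y _ _ hdim _.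
  case: (real_dim2_indep (a := 1) hdim).
  by rewrite scale1r [X]thinmx0 [Y]thinmx0.
have [r r0 Xr] := Umn_sqr_norm n0 hX.
have [s s0 Ys] := Umn_sqr_norm n0 hY.
have [mu Xmu] := hXY; have {}Xmu : X^H *m Y = mu%:C%:M by [].
have rn : r != 0 by rewrite gt_eqF.
have Ymu : Y^H *m X = mu%:C%:M.
  by rewrite -[X]adjmxK -adjmxM Xmu -[_%:M]scalemx1 adjmxZ adjmx1 scalemx1.
(* Gram-Schmidt: Z is the component of Y orthogonal to X. *)
pose b := - mu / r ^+ 2; pose Z := Y + b%:C *: X.
have XZ : X^H *m Z = 0.
  rewrite mulmxDr -scalemxAr Xr Xmu scale_scalar_mx -raddfD /= -rmorphM -rmorphD.
  by rewrite /b divfK ?expf_neq0 // subrr raddf0.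
pose l := s ^+ 2 + b * mu.
have ZZ : Z^H *m Z = l%:C%:M.
  rewrite {1}/Z adjmxD adjmxZ mulmxDl -scalemxAl XZ scaler0 addr0 mulmxDr -scalemxAr.
  by rewrite Ys Ymu scale_scalar_mx -raddfD /= -rmorphM -rmorphD.
have Z0 : Z != 0.
  apply/eqP => Z0; apply: (real_dim2_indep (a := - b) hdim).
  by rewrite -hatZ rmorphN scaleNr; congr hat; apply/eqP; rewrite -addr_eq0 -/Z Z0.
have UZ : Umn Z.
  exists l%:C; last exact: ZZ.
  apply: contra_neq Z0 => l0; apply/matrixP => i j; rewrite mxE.
  have := congr1 (fun A : 'M[R[i]]_n => A j j) ZZ; rewrite l0 !mxE mul0rn => /eqP.
  rewrite psumr_eq0 => [/allP/(_ i)|k _]; last by rewrite /adjmx !mxE mulrC -normCK exprn_ge0.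
  rewrite mem_index_enum /adjmx !mxE mulrC -normCK => /(_ isT).
  by rewrite expf_eq0 normr_eq0 /= => /eqP.
have [d d0 Zd] := Umn_sqr_norm n0 UZ.
have dn : d != 0 by rewrite gt_eqF.
rewrite -(@spanR_recombine _ _ (hat X) (hat Y) r^-1 b d^-1) ?invr_eq0 //.
rewrite -!hatZ -hatD -/Z -hatZ.
apply: rp2_gives_rise => //; rewrite adjmxZ -scalemxAl -scalemxAr.
- by rewrite Xr !scale_scalar_mx -!rmorphM mulrA -expr2 exprVn mulVf ?expf_neq0.
- by rewrite Zd !scale_scalar_mx -!rmorphM mulrA -expr2 exprVn mulVf ?expf_neq0.
- by rewrite XZ !scaler0.
Qed.
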